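(* Let $2\le k\le n$, $\Omega\subset\mathbb{R}^n$ a bounded domain with smooth boundary, $\mathcal D=\overline\Omega\times\mathbb R\times\mathbb R^n$, $\varphi$ a smooth function on $\partial\Omega$ (smoothly extended to a neighborhood), and let $\delta,\widetilde\gamma_k$ satisfy $0<\gamma_k<\widetilde\gamma_k<1$, $0<\delta<\delta_k<1$. Assume: (i) $A\in C^3(\mathcal D)$ is symmetric-matrix valued and satisfies $A(x,z,p)\ge-\gamma_0(1+|p|^2)E_n$ for some $\gamma_0>0$, $\lambda_{\max}(A(x,z,0))\ge0$, and $D_zA(x,z,p)\ge0$ on $\mathcal D$; (ii) $f\in C^3(\mathcal D)$, $f>0$ on $\mathcal D$, and $\inf_{\mathcal D}\big[D_zf/f\big]\ge\frac{k\delta}{1+\delta^2}\beta_1$ for some $\beta_1>0$; (iii) there exists a $\widetilde\gamma_k$-admissible subsolution $\underline u$ of the symmetric problem $S_k(D^2u-A(x,u,Du))=f(x,u,Du)$ in $\Omega$, $u=\varphi$ on $\partial\Omega$; (iv) $u\in C^2(\overline\Omega)$ is a $(\delta,\widetilde\gamma_k)$-admissible solution of $S_k(D^2u-A(x,u,Du)-B(x,u,Du))=f(x,u,Du)$ in $\Omega$, $u=\varphi$ on $\partial\Omega$; (v) $B\in BC^3(\mathcal D)$ is skew-symmetric-matrix valued with $\mu(B)\le\delta\min(\lambda_u,\lambda_{\underline u})$ and $\mu(D_zB)\le\beta_1\min(\lambda_u,\lambda_{\underline u})$. Then there exist $M_0,M_1,C_3>0$ depending only on $\delta,k,n,\widetilde\gamma_k,\beta_1,\Omega,A,\underline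 u,f,\varphi$ (and not otherwise on $u$ or $B$) such that $\sup_{\overline\Omega}|u|\le M_0$, $\sup_{\overline\Omega}|Du|\le M_1$ and $\|u\|_{C^2(\overline\Omega)}\le C_3$.
   Context: For $R\in\mathbb{R}^{n\times n}$, $S_k(R)=\sigma_k(\lambda(R))$, where $\lambda(R)\in\mathbb{C}^n$ are the eigenvalues of $R$ and $\sigma_k(\lambda)=\sum_{1\le i_1<\dots<i_k\le n}\lambda_{i_1}\cdots\lambda_{i_k}$. $E_n$ is the identity matrix; matrix inequalities are in the sense of quadratic forms. For $u\in C^2(\overline\Omega)$: $\omega(x,u)=D^2u-A(x,u,Du)$, $R(x,u)=\omega(x,u)-B(x,u,Du)$, $\lambda_u=\inf_{\overline\Omega}\lambda_{\min}(\omega(x,u))$, $\gamma_u=\inf_{\overline\Omega}\lambda_{\min}(\omega(x,u))/\lambda_{\max}(\omega(x,u))$; $\mu(B)=\sup_{\mathcal D}\|B\|$, $\mu(D_zB)=\sup_{\mathcal D}\|D_zB\|$ (operator norms). Strictly admissible: $\lambda_u>0$; $\delta$-admissible: strictly admissible and $\mu(B)\le\delta\lambda_u$; $\widetilde\gamma_k$-admissible: strictly admissible and $\gamma_u\ge\widetilde\gamma_k$; $(\delta,\widetilde\gamma_k)$-admissible: both. A subsolution of a Dirichlet problem $S_k(\cdot)=f$ in $\Omega$, $u=\varphi$ on $\partial\Omega$, is $\underline u\in C^2(\overline\Omega)$ with $S_k(\cdot)\ge f$ in $\Omega$ and $\underline u=\varphi$ on $\partial\Omega$ (for the symmetric problem,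 $\omega(x,\underline u)=D^2\underline u-A$ is used in the admissibility definitions). Constants: $\gamma_k\in(0,1)$ is given by $\gamma_k=(n-k)/k$ if $[n/2]+1\le k\le n-2$, $\gamma_k=(k-2)/(n-k+2)$ if $4\le k\le[n/2]$, and is a certain fixed number in $(0,1)$ if $k\in\{2,3,n-1,n\}$. Writing $D_{\delta,\mu}=\{R=\omega+\beta:\omega^T=\omega>0,\beta^T=-\beta,\|\beta\|\le\mu\le\delta\lambda_{\min}(\omega)\}$ and $D_{\delta,\mu,\widetilde\gamma_k}=\{R=\omega+\beta\in D_{\delta,\mu}:\lambda_{\min}(\omega)\ge\widetilde\gamma_k\lambda_{\max}(\omega)\}$, $\delta_k\in(0,1)$ is a constant depending on $k,n,\widetilde\gamma_k$ (any number in $(0,1)$ if $k=n$) such that for all $0<\delta<\delta_k$ there are $C_1,C_2>0$ with, for $F_k(R)=\log S_k(R)$: $d^2F_k(R,P)\le -C_1|P|^2/\lambda_{\min}^2(\omega)$ for symmetric $P$, $d^2F_k(R,P+Q)\le C_2|Q|^2/\lambda_{\min}^2(\omega)$ for symmetric $P$ and skew $Q$, for all $R=\omega+\beta\in D_{\delta,\mu,\widetilde\gamma_k}$, $\mu>0$. *)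

(* Defs.v *)
From HB Require Import structures.
From mathcomp Require Import all_boot all_order all_algebra.
From mathcomp Require Import all_classical all_reals all_analysis.
From mathcomp Require Import complex.
Set Implicit Arguments. Unset Strict Implicit. Unset Printing Implicit Defensive.
Import Order.TTheory GRing.Theory Num.Theory.
Import numFieldNormedType.Exports.
Local Open Scope classical_set_scope.
Local Open Scope ring_scope.

Section Defs.
Variable R : realType.

Definition vnorm m (v : 'rV[R]_m) : R := Num.sqrt (\sum_i v 0 i ^+ 2).

Definition fnorm m (P : 'M[R]_m) : R := Num.sqrt (\sum_i \sum_j P i j ^+ 2).

Definition opnorm m (M : 'M[R]_m) : R :=
  sup [set vnorm (v *m M^T) | v in [set v : 'rV[R]_m | vnorm v <= 1]].

Definition sym_mx m (M : 'M[R]_m) : Prop := M^T = M.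
Definition skew_mx m (M : 'M[R]_m) : Prop := M^T = - M.

Definition qform m (M : 'M[R]_m) (v : 'rV[R]_m) : R := (v *m M *m v^T) 0 0.

Definition mx_ge_scalar m (M : 'M[R]_m) (c : R) : Prop :=
  forall v : 'rV[R]_m, c * vnorm v ^+ 2 <= qform M v.

Definition mx_posdef m (M : 'M[R]_m) : Prop :=
  forall v : 'rV[R]_m, v != 0 -> 0 < qform M v.

(* smallest / largest (real) eigenvalue; used for symmetric matrices *)
Definition lmin m (M : 'M[R]_m) : R := inf [set a : R | eigenvalue M a].
Definition lmax m (M : 'M[R]_m) : R := sup [set a : R | eigenvalue M a].

(* the complex eigenvalues lambda(M), with algebraic multiplicity:
   the roots of the characteristic polynomial over R[i] *)
Definition eigs m (M : 'M[R]_m) : seq (complex.complex R) :=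
  let Mc : 'M[complex.complex R]_m := \matrix_(i, j) complex.Complex (M i j) 0 in
  sval (closed_field_poly_normal (char_poly Mc)).

Definition sigmak (F : comNzRingType) (k : nat) (s : seq F) : F :=
  \sum_(I : {set 'I_(size s)} | #|I| == k) \prod_(i in I) s`_i.

(* S_k(M) = sigma_k(lambda(M)) (a real number; we take its real part) *)
Definition Sk (k : nat) m (M : 'M[R]_m) : R := complex.Re (sigmak k (eigs M)).

Definition Fk (k : nat) m (M : 'M[R]_m) : R := ln (Sk k M).
Definition d2Fk (k : nat) m (M P : 'M[R]_m) : R :=
  derive1n 2 (fun t : R => Fk k (M + t *: P)) 0.

(* gamma_k: the explicit values where the paper gives them,
   otherwise (k in {2,3,n-1,n}) a number in (0,1) *)
Definition gammak_spec (n k : nat) (g : R) : Prop :=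
  (0 < g < 1) /\
  ((n./2.+1 <= k <= n - 2)%N -> g = (n - k)%:R / k%:R) /\
  ((4 <= k <= n./2)%N -> g = (k - 2)%:R / (n - k + 2)%:R).

(* the set D_{delta,mu,gt} of matrices R = omega + beta *)
Definition Dset_dmg n (delta mu gt : R) (om be : 'M[R]_n) : Prop :=
  sym_mx om /\ mx_posdef om /\ skew_mx be /\
  opnorm be <= mu /\ mu <= delta * lmin om /\ gt * lmax om <= lmin om.

Definition deltak_spec (n k : nat) (gt dk : R) : Prop :=
  (0 < dk < 1) /\
  forall delta : R, 0 < delta < dk ->
    exists C1 C2 : R, 0 < C1 /\ 0 < C2 /\
      forall mu : R, 0 < mu -> forall om be : 'M[R]_n,
        Dset_dmg delta mu gt om be ->
        (forall P : 'M[R]_n, sym_mx P ->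
           d2Fk k (om + be) P <= - C1 * fnorm P ^+ 2 / lmin om ^+ 2) /\
        (forall P Q : 'M[R]_n, sym_mx P -> skew_mx Q ->
           d2Fk k (om + be) (P + Q) <= C2 * fnorm Q ^+ 2 / lmin om ^+ 2).

Definition evec m (i : 'I_m) : 'rV[R]_m := delta_mx 0 i.

Fixpoint dpart m (l : seq 'I_m) (f : 'rV[R]_m -> R) : 'rV[R]_m -> R :=
  match l with
  | [::] => f
  | i :: l' => fun x => 'D_(evec i) (dpart l' f) x
  end.

Definition CkOn m (k : nat) (U : set 'rV[R]_m) (f : 'rV[R]_m -> R) : Prop :=
  forall l : seq 'I_m, (size l <= k)%N ->
    (forall x, U x -> {for x, continuous (dpart l f)}) /\
    ((size l < k)%N -> forall (i : 'I_m) x, U x -> derivable (dpart l f) x (evec i)).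

Definition CkClosed m (k : nat) (S : set 'rV[R]_m) (f : 'rV[R]_m -> R) : Prop :=
  exists U : set 'rV[R]_m, open U /\ S `<=` U /\ CkOn k U f.

Definition SmoothNear m (S : set 'rV[R]_m) (f : 'rV[R]_m -> R) : Prop :=
  exists U : set 'rV[R]_m, open U /\ S `<=` U /\ forall k, CkOn k U f.

Definition bounded_domain_smooth n (Om : set 'rV[R]_n) : Prop :=
  open Om /\ connected Om /\ Om !=set0 /\
  (exists M : R, forall x, Om x -> vnorm x <= M) /\
  forall x0, (closure Om `\` Om) x0 ->
    exists r : R, 0 < r /\ exists rho : 'rV[R]_n -> R,
      (forall k, CkOn k (ball x0 r) rho) /\
      (forall x, ball x0 r x -> exists i, 'D_(evec i) rho x != 0) /\
      (forall x, ball x0 r x -> (Om x <-> rho x < 0)).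

Definition grad n (u : 'rV[R]_n -> R) (x : 'rV[R]_n) : 'rV[R]_n :=
  \row_i 'D_(evec i) u x.
Definition hess n (u : 'rV[R]_n -> R) (x : 'rV[R]_n) : 'M[R]_n :=
  \matrix_(i, j) 'D_(evec i) (fun y => 'D_(evec j) u y) x.

Definition packD n (F : 'rV[R]_n -> R -> 'rV[R]_n -> R) :
  'rV[R]_(n + (1 + n)) -> R :=
  fun w => F (lsubmx w) (lsubmx (rsubmx w) 0 0) (rsubmx (rsubmx w)).

Definition setD_ n (Om : set 'rV[R]_n) : set 'rV[R]_(n + (1 + n)) :=
  [set w | closure Om (lsubmx w)].

Definition CkD n (k : nat) (Om : set 'rV[R]_n) (F : 'rV[R]_n -> R -> 'rV[R]_n -> R) :=
  CkClosed k (setD_ Om) (packD F).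

Definition BCkD n (k : nat) (Om : set 'rV[R]_n) (F : 'rV[R]_n -> R -> 'rV[R]_n -> R) :=
  CkD k Om F /\ exists M : R, forall l, (size l <= k)%N ->
    forall w, setD_ Om w -> `|dpart l (packD F) w| <= M.

Definition mxCkD n (k : nat) Om (A : 'rV[R]_n -> R -> 'rV[R]_n -> 'M[R]_n) :=
  forall i j, CkD k Om (fun x z p => A x z p i j).
Definition mxBCkD n (k : nat) Om (A : 'rV[R]_n -> R -> 'rV[R]_n -> 'M[R]_n) :=
  forall i j, BCkD k Om (fun x z p => A x z p i j).

Definition Dz n (F : 'rV[R]_n -> R -> 'rV[R]_n -> R) x z p : R :=
  derive1 (fun t => F x t p) z.
Definition mxDz n (A : 'rV[R]_n -> R -> 'rV[R]_n -> 'M[R]_n) x z p : 'M[R]_n :=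
  \matrix_(i, j) derive1 (fun t => A x t p i j) z.

Definition muD n (Om : set 'rV[R]_n) (B : 'rV[R]_n -> R -> 'rV[R]_n -> 'M[R]_n) : R :=
  sup [set r : R | exists x z p, closure Om x /\ r = opnorm (B x z p)].

Definition omega n (A : 'rV[R]_n -> R -> 'rV[R]_n -> 'M[R]_n) (u : 'rV[R]_n -> R) x :=
  hess u x - A x (u x) (grad u x).

Definition lambda_u n (Om : set 'rV[R]_n) A (u : 'rV[R]_n -> R) : R :=
  inf [set lmin (omega A u x) | x in closure Om].

Definition gamma_u n (Om : set 'rV[R]_n) A (u : 'rV[R]_n -> R) : R :=
  inf [set lmin (omega A u x) / lmax (omega A u x) | x in closure Om].

Definition strictly_admissible n Om A (u : 'rV[R]_n -> R) : Prop :=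
  0 < lambda_u Om A u.
Definition delta_admissible n Om A B (delta : R) (u : 'rV[R]_n -> R) : Prop :=
  strictly_admissible Om A u /\ muD Om B <= delta * lambda_u Om A u.
Definition gamma_admissible n Om A (gt : R) (u : 'rV[R]_n -> R) : Prop :=
  strictly_admissible Om A u /\ gt <= gamma_u Om A u.
Definition delta_gamma_admissible n Om A B (delta gt : R) (u : 'rV[R]_n -> R) : Prop :=
  delta_admissible Om A B delta u /\ gamma_admissible Om A gt u.

Definition supOm n (Om : set 'rV[R]_n) (g : 'rV[R]_n -> R) : R :=
  sup [set g x | x in closure Om].

Definition C2norm n (Om : set 'rV[R]_n) (u : 'rV[R]_n -> R) : R :=
  supOm Om (fun x => `|u x|)
  + \sum_i supOm Om (fun x => `|'D_(evec i) u x|)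
  + \sum_i \sum_j supOm Om (fun x => `|hess u x i j|).

End Defs.

(* Main.v *)
Require Import Defs.
From HB Require Import structures.
From mathcomp Require Import all_boot all_order all_algebra.
From mathcomp Require Import all_classical all_reals all_analysis.
From mathcomp Require Import perm complex.
From mathcomp Require Import ring lra.

(** If the quadratic form of a matrix [N], symmetric or not, dominates that of a
    positive definite symmetric [P], then [\det P <= \det N]; applied to the
    principal minors this gives [Sk k P <= Sk k N], so that a skew perturbation
    never decreases [Sk].  At an interior
    negative minimum of [u - ul] this contradicts the strict monotonicity of [f]
    and the monotonicity of [A] in [z], so [ul <= u].  An interior maximum of [u]
    would make [A x u 0] negative definite, so [u] is bounded by its boundary
    values.  The gradient bound comes from maximizing
    [|Du|^2 exp (4 gamma0 u)].  Finally [lmin (omega) ^ k <= Sk k (omega - B) = f]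
    bounds the smallest eigenvalue of [omega], hence the largest one through
    [gamma_u], hence the Hessian. *)

Set Implicit Arguments. Unset Strict Implicit. Unset Printing Implicit Defensive.
Import Order.TTheory GRing.Theory Num.Theory.
Import numFieldNormedType.Exports.
Local Open Scope classical_set_scope.
Local Open Scope ring_scope.

(** * Principal minors and monotonicity of [Sk] *)

(** [omega - B] is not symmetric, so its eigenvalues cannot be compared one by one with those of a
    symmetric matrix. [Sk] is therefore rewritten as a sum of principal minors, and Schur
    complements take over the role of eigenvalues. Each minor is padded by the identity to an [n] by
    [n] matrix, so that one determinant inequality covers all index sets without reindexing. The
    skew part enters the estimates through [qform B v = 0]. Hence [u] can be compared with a
    subsolution of the symmetric problem, and all constants can be fixed before [u] and [B] are
    introduced. The equation is never differentiated: the pinching of the eigenvalues of [omega]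
    makes the second order bound purely algebraic. Smoothness is given through iterated coordinate
    derivatives, so derivatives along arbitrary lines and the symmetry of the Hessian have to be
    established first. *)

Definition pminor_mx (F : comNzRingType) n (I : {set 'I_n}) (M : 'M[F]_n) :=
  \matrix_(i, j) if (i \in I) && (j \in I) then M i j else (i == j)%:R.

(* [\det ('X - M)] is expanded multilinearly in its rows. *)
Lemma coef_char_poly (F : comNzRingType) n (M : 'M[F]_n) k : (k <= n)%N ->
  (char_poly M)`_(n - k) =
  (-1) ^+ k * \sum_(I : {set 'I_n} | #|I| == k) \det (pminor_mx I M).
Proof.
move=> kn; rewrite /char_poly /determinant.
pose T (s : 'S_n) (I : {set 'I_n}) : F := \prod_i pminor_mx I M i (s i).
(* [I] is the set of rows in which the entry of [- M], and not the diagonal ['X], is picked. *)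
have termE (s : 'S_n) : \prod_i char_poly_mx M i (s i) =
    \sum_(I in {set 'I_n}) ((-1) ^+ #|I| * T s I)%:P * 'X^(n - #|I|).
  transitivity (\prod_i (- (M i (s i))%:P + 'X *+ (i == s i))).
    by apply: eq_bigr => i _; rewrite !mxE addrC.
  rewrite bigA_distr; apply: eq_bigr => I _.
  (* If [s] moves a row outside [I], both sides vanish: no ['X] is available off the diagonal, and
     the padded minor has an identity row there. *)
  have [i /andP[iI sii]|fixI0] := pickP (fun i => (i \notin I) && (s i != i)).
    rewrite (bigD1 i)//= (negbTE iI) eq_sym (negbTE sii) mulr0n mul0r.
    rewrite /T (bigD1 i)//= mxE (negbTE iI) /= eq_sym (negbTE sii).
    by rewrite mul0r mulr0 polyC0 mul0r.
  have fixI i : i \notin I -> s i = i.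
    by move=> iI; have := fixI0 i; rewrite iI /= => /negbFE/eqP.
  (* If [s i] were outside [I] it would be a fixed point, and injectivity would give [s i = i]. *)
  have sI i : i \in I -> s i \in I.
    move=> iI; apply: contraT => siI.
    by have /perm_inj sii := fixI _ siI; rewrite sii iI in siI.
  rewrite (bigID (mem I))/=.
  under eq_bigr => i iI do rewrite iI -polyCN.
  under [X in _ * X]eq_bigr => i iI.
    rewrite (negbTE iI) (fixI _ iI) eqxx mulr1n; over.
  rewrite -rmorph_prod/= prodrN prodr_const; congr (_ %:P * 'X^_).
    congr (_ * _); rewrite /T [RHS](bigID (mem I))/= [X in _ = _ * X]big1 ?mulr1.
      by apply: eq_bigr => i iI; rewrite mxE iI sI.
    by move=> i iI; rewrite mxE (negbTE iI) /= fixI// eqxx.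
  by rewrite -[X in (X - _)%N](card_ord n) -(cardC I) addKn.
rewrite (eq_bigr _ (fun s _ => congr1 (fun x => _ * x) (termE s))).
under eq_bigr => s _ do rewrite mulr_sumr.
rewrite exchange_big /= coef_sum mulr_sumr [RHS]big_mkcond /=.
apply: eq_bigr => I _; rewrite coef_sum.
have E : (n - k == n - #|I|)%N = (#|I| == k).
  have := max_card (mem I); rewrite card_ord => In.
  by apply/eqP/eqP => [|-> //]; move=> e; apply/eqP; rewrite -(eqn_add2l (n - k))
    subnK // e subnK.
under eq_bigr => s _ do
  rewrite mulrA -[(-1) ^+ s]/((-1 : {poly F}) ^+ s) -polyC1 -polyCN -rmorphXn/=
    -rmorphM/= coefCM coefXn E.
case: eqP => [->|_]; last by rewrite big1// => s _; rewrite mulr0.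
rewrite mulr_sumr; apply: eq_bigr => s _.
by rewrite mulr1 mulrCA.
Qed.

(** By Vieta, both sides are, up to the same sign, the coefficient of degree [n - k] of the
    characteristic polynomial over the complex numbers. The minors of the complexified matrix are
    real, so taking the real part in [Sk] loses nothing. *)
Lemma Sk_pminors (R : realType) n k (M : 'M[R]_n) : (k <= n)%N ->
  Sk k M = \sum_(I : {set 'I_n} | #|I| == k) \det (pminor_mx I M).
Proof.
move=> kn; rewrite /Sk /eigs; set Mc := \matrix_(_, _) _.
case: closed_field_poly_normal => s /= sE.
have sM := char_poly_monic Mc.
move: sE; rewrite (monicP sM) scale1r => sE.
have szs : size s = n.
  by apply: succn_inj; rewrite -(size_char_poly Mc) sE size_prod_XsubC.
have := coef_char_poly Mc kn.
rewrite sE coef_prod_XsubC; last by rewrite szs leq_subr.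
have -> : (size s - (n - k) = k)%N by rewrite szs subKn.
move=> /(mulrI (unitrX k (unitrN1 _))) eqS.
have -> : sigmak k s = \sum_(I : {set 'I_n} | #|I| == k) \det (pminor_mx I Mc).
  by rewrite -eqS.
have -> : \sum_(I : {set 'I_n} | #|I| == k) \det (pminor_mx I Mc) =
   ((\sum_(I : {set 'I_n} | #|I| == k) \det (pminor_mx I M))%:C)%C.
  rewrite rmorph_sum; apply: eq_bigr => I _; rewrite -det_map_mx.
  congr (\det _); apply/matrixP => i j; rewrite !mxE.
  by case: ifP => // _; rewrite rmorph_nat.
by [].
Qed.

Section QuadraticForms.
Variable R : realType.

Definition qdot n (u v : 'rV[R]_n) : R := (u *m v^T) 0 0.

Lemma qdotE n (u v : 'rV[R]_n) : qdot u v = \sum_i u 0 i * v 0 i.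
Proof. by rewrite /qdot mxE; apply: eq_bigr => i _; rewrite mxE. Qed.

Lemma qdotC n (u v : 'rV[R]_n) : qdot u v = qdot v u.
Proof. by rewrite !qdotE; apply: eq_bigr => i _; rewrite mulrC. Qed.

Lemma qdotDl n (u v w : 'rV[R]_n) : qdot (u + v) w = qdot u w + qdot v w.
Proof. by rewrite /qdot mulmxDl mxE. Qed.

Lemma qdotZl n a (u w : 'rV[R]_n) : qdot (a *: u) w = a * qdot u w.
Proof. by rewrite /qdot -scalemxAl mxE. Qed.

Lemma qdotDr n (u v w : 'rV[R]_n) : qdot w (u + v) = qdot w u + qdot w v.
Proof. by rewrite ![qdot w _]qdotC qdotDl. Qed.

Lemma qdotZr n a (u w : 'rV[R]_n) : qdot w (a *: u) = a * qdot w u.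
Proof. by rewrite ![qdot w _]qdotC qdotZl. Qed.

Lemma qdotvv_ge0 n (u : 'rV[R]_n) : 0 <= qdot u u.
Proof. by rewrite qdotE sumr_ge0// => i _; rewrite -expr2 sqr_ge0. Qed.

Lemma qdotvv_eq0 n (u : 'rV[R]_n) : (qdot u u == 0) = (u == 0).
Proof.
apply/eqP/eqP => [|->]; last by rewrite qdotE big1// => i _; rewrite mxE mul0r.
rewrite qdotE => /eqP; rewrite psumr_eq0 => [/allP h|i _]; last by rewrite -expr2 sqr_ge0.
apply/rowP => i; rewrite mxE; have := h i (mem_index_enum i).
by rewrite -expr2 sqrf_eq0 => /eqP.
Qed.

Lemma vnorm_sqr n (v : 'rV[R]_n) : vnorm v ^+ 2 = qdot v v.
Proof.
rewrite /vnorm sqr_sqrtr ?qdotE; first by apply: eq_bigr => i _; rewrite expr2.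
by rewrite sumr_ge0// => i _; rewrite sqr_ge0.
Qed.

Lemma vnorm_ge0 n (v : 'rV[R]_n) : 0 <= vnorm v.
Proof. exact: sqrtr_ge0. Qed.

Lemma qformE n (M : 'M[R]_n) v : qform M v = \sum_i \sum_j v 0 i * M i j * v 0 j.
Proof.
rewrite /qform -[(_ *m v^T) 0 0]/(qdot (v *m M) v) qdotE exchange_big /=.
by apply: eq_bigr => j _; rewrite mxE mulr_suml.
Qed.

Lemma qformD n (M N : 'M[R]_n) v : qform (M + N) v = qform M v + qform N v.
Proof. by rewrite /qform mulmxDr mulmxDl mxE. Qed.

Lemma qformN n (M : 'M[R]_n) v : qform (- M) v = - qform M v.
Proof. by rewrite /qform mulmxN mulNmx mxE. Qed.

Lemma qformB n (M N : 'M[R]_n) v : qform (M - N) v = qform M v - qform N v.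
Proof. by rewrite qformD qformN. Qed.

Lemma qform_scalar n (c : R) (v : 'rV[R]_n) : qform c%:M v = c * qdot v v.
Proof. by rewrite /qform mul_mx_scalar -scalemxAl mxE. Qed.

Lemma qform_tr n (M : 'M[R]_n) v : qform M^T v = qform M v.
Proof.
rewrite /qform.
have -> : v *m M^T *m v^T = (v *m M *m v^T)^T by rewrite !trmx_mul trmxK mulmxA.
by rewrite mxE.
Qed.

Lemma qform_skew n (M : 'M[R]_n) v : skew_mx M -> qform M v = 0.
Proof.
move=> Ms; have := qform_tr M v; rewrite Ms qformN => /eqP.
by rewrite eq_sym -subr_eq0 opprK -mulr2n mulrn_eq0 /= => /eqP.
Qed.

Lemma qform0 n (M : 'M[R]_n) : qform M 0 = 0.
Proof. by rewrite /qform !mul0mx mxE. Qed.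

Lemma qformZ n (M : 'M[R]_n) a v : qform M (a *: v) = a ^+ 2 * qform M v.
Proof. by rewrite /qform linearZ /= -scalemxAr -!scalemxAl !mxE mulrA expr2. Qed.

(** * Schur complements and comparison of determinants *)

Lemma mx11_mul (A B : 'M[R]_1) : (A *m B) 0 0 = A 0 0 * B 0 0.
Proof. by rewrite mxE big_ord1. Qed.

Lemma qform_block n a (b : 'rV[R]_n) (c : 'cV[R]_n) (D : 'M[R]_n) (x : R) (v : 'rV[R]_n) :
  qform (block_mx a%:M b c D : 'M[R]_(1 + n)) (row_mx x%:M v : 'rV[R]_(1 + n)) =
  a * x ^+ 2 + x * qdot b v + x * qdot v c^T + qform D v.
Proof.
have addE (A B : 'M[R]_1) : (A + B) 0 0 = A 0 0 + B 0 0 by rewrite mxE.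
rewrite /qform mul_row_block tr_row_mx mul_row_col !mulmxDl !addE tr_scalar_mx.
rewrite -scalar_mxM !mul_scalar_mx !mx11_mul -scalemxAl /qdot trmxK !mxE eqxx !mulr1n.
ring.
Qed.

Lemma det_block_schur n (a : R) (b : 'rV[R]_n) (c : 'cV[R]_n) (D : 'M[R]_n) : a != 0 ->
  \det (block_mx a%:M b c D : 'M[R]_(1 + n)) = a * \det (D - a^-1 *: (c *m b)).
Proof.
move=> a0; have -> : block_mx a%:M b c D =
  (block_mx 1%:M 0 (a^-1 *: c) 1%:M : 'M[R]_(1 + n)) *m
  block_mx a%:M b 0 (D - a^-1 *: (c *m b)).
  rewrite mulmx_block !mul1mx !mul0mx !addr0 mul_mx_scalar scalerA divff// scale1r.
  by rewrite -scalemxAl addrC subrK.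
by rewrite det_mulmx det_lblock det_ublock !det1 !mul1r det_scalar1.
Qed.

Lemma qform_schur n (a : R) (b : 'rV[R]_n) (c : 'cV[R]_n) (D : 'M[R]_n) v :
  qform (D - a^-1 *: (c *m b)) v = qform D v - a^-1 * (qdot v c^T * qdot b v).
Proof.
rewrite qformB; congr (_ - _).
rewrite /qform -scalemxAr -scalemxAl mxE; congr (_ * _).
by rewrite mulmxA -(mulmxA (v *m c)) mx11_mul /qdot trmxK.
Qed.

(* Induction on Schur complements.  The form of the Schur complement of [N] at
   [v] is the value of [qform N] at [(- qdot b v / a, v)], while that of the
   symmetric [P] is the minimum of [qform P] over all [(x, v)]. *)
Lemma det_qform_le n (P N : 'M[R]_n) : sym_mx P -> mx_posdef P ->
  (forall v, qform P v <= qform N v) -> 0 < \det P <= \det N.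
Proof.
elim: n P N => [|n IHn] P N; first by move=> _ _ _; rewrite !det_mx00 ltr01 lexx.
rewrite -[n.+1]/(1 + n)%N in P N *.
have bE (M : 'M[R]_(1 + n)) : M = block_mx (M 0 0)%:M (ursubmx M) (dlsubmx M) (drsubmx M).
  rewrite -[LHS]submxK; congr block_mx; rewrite [LHS]mx11_scalar !mxE.
  by congr ((M _ _)%:M); apply/val_inj.
rewrite (bE P) (bE N).
move: (P 0 0) (ursubmx P) (dlsubmx P) (drsubmx P) => a b c D.
move: (N 0 0) (ursubmx N) (dlsubmx N) (drsubmx N) => a' b' c' D'.
rewrite /sym_mx tr_block_mx => /eq_block_mx[_ cb _ Ds] Ppos PN.
have {}cb : c = b^T by rewrite -cb trmxK.
subst c.
have a0 : 0 < a.
  have := Ppos (row_mx 1%:M 0); rewrite qform_block /qdot qform0 trmx0 mul0mx mulmx0 !mxE.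
  rewrite expr1n !mulr1 !mulr0 !addr0; apply.
  apply/eqP => /rowP/(_ (lshift n 0)); rewrite row_mxEl !mxE => /eqP.
  by rewrite oner_eq0.
have aa' : a <= a'.
  have := PN (row_mx 1%:M 0); rewrite !qform_block /qdot !qform0 trmx0 !mul0mx !mulmx0 !mxE.
  by rewrite expr1n !mulr1 !mulr0 !addr0.
have a'0 : 0 < a' by exact: lt_le_trans aa'.
rewrite !det_block_schur ?gt_eqF//.
have sPos : mx_posdef (D - a^-1 *: (b^T *m b)).
  move=> v v0; rewrite qform_schur trmxK.
  have := Ppos (row_mx (- (qdot b v / a))%:M v).
  rewrite qform_block trmxK [qdot v b]qdotC.
  have -> : a * (- (qdot b v / a)) ^+ 2 + - (qdot b v / a) * qdot b v +
     - (qdot b v / a) * qdot b v + qform D v = qform D v - a^-1 * (qdot b v * qdot b v).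
    by field; rewrite gt_eqF.
  apply; apply: contra_neq v0.
  by rewrite -(row_mx0 _ 1 1 n) => /eq_row_mx[].
have sSym : sym_mx (D - a^-1 *: (b^T *m b)).
  by rewrite /sym_mx linearB linearZ /= trmx_mul trmxK Ds.
have sle v : qform (D - a^-1 *: (b^T *m b)) v <= qform (D' - a'^-1 *: (c' *m b')) v.
  rewrite !qform_schur trmxK [qdot v b]qdotC.
  set p := qdot b' v; set q := qdot v _; set r := qdot b v.
  have := PN (row_mx (- (p / a'))%:M v); rewrite !qform_block trmxK [qdot v b]qdotC -/r -/p -/q.
  have -> : a' * (- (p / a')) ^+ 2 + - (p / a') * p + - (p / a') * q + qform D' v =
    qform D' v - a'^-1 * (q * p) by field; rewrite gt_eqF.
  apply: le_trans; rewrite -subr_ge0.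
  set x := - (p / a').
  have -> : a * x ^+ 2 + x * r + x * r + qform D v - (qform D v - a^-1 * (r * r)) =
    a * (x + r / a) ^+ 2 by field; rewrite gt_eqF.
  by rewrite mulr_ge0 ?sqr_ge0// ltW.
have /andP[d0 dle] := IHn _ _ sSym sPos sle.
by rewrite mulr_gt0//= ler_pM// ltW.
Qed.

Definition vproj n (I : {set 'I_n}) (v : 'rV[R]_n) : 'rV[R]_n :=
  \row_i (v 0 i *+ (i \in I)).

(** The padding adds the same squares whatever [M] is, so passing to minors preserves both
    positivity and the order between forms. *)
Lemma qform_pminor n (I : {set 'I_n}) (M : 'M[R]_n) v :
  qform (pminor_mx I M) v = qform M (vproj I v) + \sum_(i | i \notin I) v 0 i ^+ 2.
Proof.
rewrite !qformE [X in _ = _ + X]big_mkcond -big_split /=; apply: eq_bigr => i _.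
under eq_bigr do rewrite mxE; under [X in _ = X + _]eq_bigr do rewrite !mxE.
case: (boolP (i \in I)) => iI /=.
  rewrite addr0; apply: eq_bigr => j _; rewrite mulr1n.
  by case: (boolP (j \in I)) => jI; rewrite ?mulr1n// (_ : i == j = false) ?mulr0 ?mul0r//;
    apply: contraNF jI => /eqP <-.
rewrite [X in _ = X + _]big1 ?add0r => [|j _]; last by rewrite !mul0r.
rewrite (bigD1 i)//= eqxx mulr1 big1 ?addr0 ?expr2// => j ji.
by rewrite eq_sym (negbTE ji) mulr0 mul0r.
Qed.

Lemma Sk_qform_le n k (P N : 'M[R]_n) : (k <= n)%N -> sym_mx P -> mx_posdef P ->
  (forall v, qform P v <= qform N v) -> Sk k P <= Sk k N.
Proof.
move=> kn Ps Pp PN; rewrite !Sk_pminors//; apply: ler_sum => I _.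
suff /andP[] : 0 < \det (pminor_mx I P) <= \det (pminor_mx I N) by [].
apply: det_qform_le => [|v v0|v]; last by rewrite !qform_pminor lerD2r.
  apply/matrixP => i j; rewrite !mxE andbC (eq_sym j).
  by rewrite -[in LHS]Ps mxE.
(* Either the part of [v] on [I] is nonzero and [P] is positive there, or [v] lives outside [I] and
   the identity block is positive. *)
rewrite qform_pminor; have [pv0|pv0] := eqVneq (vproj I v) 0; last first.
  by rewrite ltr_wpDr ?Pp// sumr_ge0// => i _; rewrite sqr_ge0.
rewrite pv0 qform0 add0r.
have [i vi] : exists i, v 0 i != 0.
  apply/fintype.existsP; apply: contraNT v0; rewrite negb_exists => /fintype.forallP h.
  by apply/eqP/rowP => i; rewrite mxE; apply/eqP; have := h i; rewrite negbK.
have iI : i \notin I.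
  apply: contraNN vi => iI; have /rowP/(_ i) := pv0; rewrite !mxE iI mulr1n => ->.
  by rewrite eqxx.
rewrite (bigD1 i)//= ltr_pwDl ?exprn_even_gt0// sumr_ge0// => j _.
by rewrite sqr_ge0.
Qed.

(** Scalar matrices are the comparison matrices when [lmin] is bounded by [Sk]. *)
Lemma Sk_scalar n k (c : R) : (k <= n)%N -> Sk k (c%:M : 'M[_]_n) = 'C(n, k)%:R * c ^+ k.
Proof.
move=> kn; rewrite Sk_pminors//.
rewrite (eq_bigr (fun=> c ^+ k)) => [|I /eqP Ik].
  rewrite sumr_const -[X in _ = 'C(X, k)%:R * _]card_ord -card_draws mulr_natl.
  by congr (_ *+ _); apply: eq_card => I; rewrite !inE.
have -> : pminor_mx I c%:M = diag_mx (\row_i (if i \in I then c else 1)).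
  apply/matrixP => i j; rewrite !mxE; have [->|] := eqVneq i j.
    by rewrite andbb !mulr1n.
  by rewrite !mulr0n; case: ifP.
rewrite det_diag; under eq_bigr do rewrite mxE.
by rewrite -big_mkcond prodr_const Ik.
Qed.

(** * Rayleigh quotients and extreme eigenvalues *)

Definition bform n (M : 'M[R]_n) (u v : 'rV[R]_n) : R := (u *m M *m v^T) 0 0.

Lemma qform_add n (M : 'M[R]_n) u v : sym_mx M ->
  qform M (u + v) = qform M u + 2 * bform M u v + qform M v.
Proof.
move=> Ms.
have -> : 2 * bform M u v = bform M u v + bform M v u.
  rewrite /bform [in X in _ = _ + X](_ : v *m M *m u^T = (u *m M *m v^T)^T) ?mxE ?mulr_natl//.
  by rewrite !trmx_mul trmxK Ms mulmxA.
by rewrite /qform /bform linearD /= !mulmxDl !mulmxDr !mxE; ring.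
Qed.

Lemma bformZr n (M : 'M[R]_n) a u v : bform M u (a *: v) = a * bform M u v.
Proof. by rewrite /bform linearZ /= -scalemxAr mxE. Qed.

Lemma bform_evec n (M : 'M[R]_n) i j : bform M (evec R i) (evec R j) = M i j.
Proof. by rewrite /bform -rowE trmx_delta -colE !mxE. Qed.

Lemma qform_evec n (M : 'M[R]_n) i : qform M (evec R i) = M i i.
Proof. exact: bform_evec. Qed.

Lemma qdot_evec n (i : 'I_n) : qdot (evec R i) (evec R i) = 1.
Proof. by rewrite /qdot trmx_delta mul_delta_mx mxE !eqxx. Qed.

Lemma continuous_sum_fun (T : topologicalType) (I : Type) (r : seq I) (F : I -> T -> R) x :
  (forall i, {for x, continuous (F i)}) ->
  {for x, continuous (fun y => \sum_(i <- r) F i y)}.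
Proof.
move=> cF; elim: r => [|i r IH].
  by rewrite (_ : (fun _ => _) = cst 0); [exact: cvg_cst|apply/funext => y; rewrite big_nil].
rewrite (_ : (fun _ => _) = F i \+ (fun y => \sum_(i <- r) F i y)).
  exact: continuousD.
by apply/funext => y; rewrite big_cons.
Qed.

Lemma continuous_qform n (M : 'M[R]_n) : continuous (qform M : 'rV[R]_n -> R).
Proof.
move=> x; rewrite (_ : qform M = fun v => \sum_i \sum_j v 0 i * M i j * v 0 j).
  apply: continuous_sum_fun => i; apply: continuous_sum_fun => j.
  apply: continuousM; last exact: coord_continuous.
  by apply: continuousM; [exact: coord_continuous|exact: cst_continuous].
by apply/funext => v; rewrite qformE.
Qed.

Lemma continuous_qdot n : continuous (fun v : 'rV[R]_n => qdot v v).
Proof.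
have -> : (fun v : 'rV[R]_n => qdot v v) = qform 1%:M.
  by apply/funext => v; rewrite qform_scalar mul1r.
exact: continuous_qform.
Qed.

Lemma sqr_coord_le_qdot n (v : 'rV[R]_n) i : v 0 i ^+ 2 <= qdot v v.
Proof.
rewrite qdotE (bigD1 i)//= -expr2 lerDl sumr_ge0// => j _.
by rewrite -expr2 sqr_ge0.
Qed.

Lemma mx_norm_le_coord m n (v : 'M[R]_(m, n)) (c : R) : 0 <= c ->
  (forall i j, `|v i j| <= c) -> `|v| <= c.
Proof.
move=> c0 vc; rewrite [leLHS]/Num.norm /= mx_normrE; by apply: bigmax_le => // -[i j] _.
Qed.

Lemma coord_le_norm m n (v : 'M[R]_(m, n)) i j : `|v i j| <= `|v|.
Proof.
rewrite [leRHS]/Num.norm /= mx_normrE; apply/bigmax_geP; right => /=.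
by exists (i, j).
Qed.

(** A minimizer [v0] of the form on the compact unit sphere is an eigenvector: [N = M - mu] is a
    nonnegative form that vanishes at [v0], so its first variation at [v0] in the direction
    [v0 *m N], which is the squared length of that vector, must be zero. *)
Lemma rayleigh_min n (M : 'M[R]_n) : (0 < n)%N -> sym_mx M ->
  exists mu (v : 'rV[R]_n), [/\ v != 0, v *m M = mu *: v & forall w, mu * qdot w w <= qform M w].
Proof.
move=> n0 Ms; pose S := [set v : 'rV[R]_n | qdot v v = 1].
have S0 : S !=set0 by exists (evec R (Ordinal n0)); exact: qdot_evec.
have cS : compact S.
  apply: bounded_closed_compact.
    exists 1; split => // x x1 v Sv; apply: le_trans (ltW x1).
    apply: mx_norm_le_coord => // i j; rewrite ord1 -[leRHS]ger0_norm// -ler_sqr ?nnegrE//.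
    by rewrite !real_normK ?num_real// expr1n -[leRHS]Sv sqr_coord_le_qdot.
  apply: (@preimage_closed _ _ (fun v : 'rV[R]_n => qdot v v) [set t | t = 1]).
    by move=> x _; exact: continuous_qdot.
  exact: closed_eq.
have [v0] := EVT_min_rV S0 cS (continuous_subspaceT (@continuous_qform n M)).
rewrite inE => Sv0 v0min.
have minM w : qform M v0 * qdot w w <= qform M w.
  have [->|w0] := eqVneq w 0; first by rewrite qform0 /qdot mul0mx mxE mulr0.
  have qw : 0 < qdot w w by rewrite lt0r qdotvv_eq0 w0 qdotvv_ge0.
  have := v0min ((Num.sqrt (qdot w w))^-1 *: w); rewrite inE.
  rewrite qformZ exprVn sqr_sqrtr ?qdotvv_ge0// => h.
  rewrite mulrC -ler_pdivlMl// h// /S /= qdotZl qdotZr mulrA -expr2 exprVn.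
  by rewrite sqr_sqrtr ?qdotvv_ge0// mulVf ?gt_eqF.
exists (qform M v0), v0; split => //.
  by rewrite -qdotvv_eq0 Sv0 oner_eq0.
set mu := qform M v0; pose N := M - mu%:M.
have Ns : sym_mx N by rewrite /sym_mx linearB /= Ms tr_scalar_mx.
have Nge w : 0 <= qform N w by rewrite qformB qform_scalar subr_ge0 minM.
have Nv0 : qform N v0 = 0 by rewrite qformB qform_scalar Sv0 mulr1 subrr.
suff : v0 *m N = 0 by rewrite mulmxBr mul_mx_scalar => /eqP; rewrite subr_eq0 => /eqP.
set g := v0 *m N; apply/eqP; rewrite -qdotvv_eq0; apply/eqP.
set s := qdot g g; set q := qform N g.
have s0 : 0 <= s := qdotvv_ge0 g.
have q0 : 0 <= q := Nge g.
have ht t : 0 <= 2 * (t * s) + t ^+ 2 * q.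
  by have := Nge (v0 + t *: g); rewrite qform_add// Nv0 add0r bformZr qformZ.
apply/eqP; rewrite eq_le s0 andbT leNgt; apply/negP => sp.
(* The vertex [- s / q] of the parabola is undefined for [q = 0]; adding [s > 0] to the denominator
   still gives a negative value. *)
have := ht (- (s / (q + s))).
have -> : 2 * (- (s / (q + s)) * s) + (- (s / (q + s))) ^+ 2 * q =
   - (s ^+ 2 * (q + 2 * s)) / (q + s) ^+ 2.
  by field; rewrite gt_eqF// ltr_wpDl.
apply/negP; rewrite -ltNge mulNr oppr_lt0 divr_gt0// ?exprn_gt0 ?ltr_wpDl//.
by rewrite mulr_gt0 ?exprn_gt0// ltr_wpDl// mulr_gt0.
Qed.

Lemma qform_eigen n (M : 'M[R]_n) a v : v *m M = a *: v -> qform M v = a * qdot v v.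
Proof. by move=> e; rewrite /qform e -scalemxAl mxE. Qed.

(** The Rayleigh minimum is an eigenvalue and also a lower bound of all of them; the latter is what
    makes the [inf] in [lmin] meaningful. *)
Lemma lmin_qform_le n (M : 'M[R]_n) w : (0 < n)%N -> sym_mx M ->
  lmin M * qdot w w <= qform M w.
Proof.
move=> n0 Ms; have [mu [v [v0 ve mumin]]] := rayleigh_min n0 Ms.
apply: le_trans (mumin w); rewrite ler_wpM2r ?qdotvv_ge0//.
have muE : eigenvalue M mu by apply/eigenvalueP; exists v.
apply: ge_inf => //; exists mu => a /= /eigenvalueP[u ue u0].
have := mumin u; rewrite (qform_eigen ue) ler_pM2r//.
by rewrite lt0r qdotvv_eq0 u0 qdotvv_ge0.
Qed.

Lemma rayleigh_max n (M : 'M[R]_n) : (0 < n)%N -> sym_mx M ->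
  (forall w, qform M w <= lmax M * qdot w w) /\
  exists2 v, v != 0 & qform M v = lmax M * qdot v v.
Proof.
move=> n0 Ms.
have [|mu [v [v0 ve mumin]]] := @rayleigh_min n (- M) n0.
  by rewrite /sym_mx linearN /= Ms.
have {}ve : v *m M = (- mu) *: v by rewrite scaleNr -ve mulmxN opprK.
have {}mumin w : qform M w <= - mu * qdot w w.
  by have := mumin w; rewrite qformN mulNr lerNr.
have muE : eigenvalue M (- mu) by apply/eigenvalueP; exists v.
have ub : ubound [set a | eigenvalue M a] (- mu).
  move=> a /= /eigenvalueP[u ue u0].
  have := mumin u; rewrite (qform_eigen ue) ler_pM2r//.
  by rewrite lt0r qdotvv_eq0 u0 qdotvv_ge0.
have -> : lmax M = - mu.
  apply/eqP; rewrite eq_le ge_sup//=; last by exists (- mu).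
  by apply: ub_le_sup => //; exists (- mu).
by split => //; exists v => //; exact: qform_eigen.
Qed.

(** Testing on [e_i + e_j] and [e_i - e_j] gives [2 |M i j| <= M i i + M j j]. *)
Lemma psd_entry_le n (M : 'M[R]_n) (c : R) : sym_mx M -> (forall w, 0 <= qform M w) ->
  (forall w, qform M w <= c * qdot w w) -> forall i j, `|M i j| <= c.
Proof.
move=> Ms M0 Mc i j.
have di := Mc (evec R i); have dj := Mc (evec R j).
rewrite qform_evec qdot_evec mulr1 in di; rewrite qform_evec qdot_evec mulr1 in dj.
have := M0 (evec R i + evec R j); have := M0 (evec R i + (-1) *: evec R j).
rewrite !qform_add// bformZr qformZ bform_evec !qform_evec.
by move=> h1 h2; rewrite ler_norml; lra.
Qed.

End QuadraticForms.

(** * One-dimensional calculus and C1 functions *)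

Section Calculus.
Variable R : realType.

Lemma near_normP (V : normedModType R) (x : V) (P : V -> Prop) :
  (\forall y \near x, P y) -> exists2 r : R, 0 < r & forall y, `|y - x| < r -> P y.
Proof.
move=> /nbhs_ballP[r /= r0 h]; exists r => // y yx; apply: h.
by rewrite -ball_normE /ball_ /= distrC.
Qed.

Lemma continuous_normP (V : normedModType R) (f : V -> R) (x : V) (e : R) :
  {for x, continuous f} -> 0 < e ->
  exists2 r : R, 0 < r & forall y, `|y - x| < r -> `|f y - f x| < e.
Proof.
move=> cf e0; apply: near_normP.
have /cvgrPdist_lt/(_ e e0) := cf.
by apply: filterS => y; rewrite distrC.
Qed.

Lemma open_normP (V : normedModType R) (U : set V) (x : V) : open U -> U x ->
  exists2 r : R, 0 < r & forall y, `|y - x| < r -> U y.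
Proof. by move=> oU Ux; apply: near_normP; exact: open_nbhs_nbhs. Qed.

Lemma add3BK (V : zmodType) (a b c : V) : a + b + c - a = b + c.
Proof. by rewrite addrAC [a + b]addrC addrK. Qed.

Lemma is_derive0P (g : R -> R) (d : R) :
  (forall e, 0 < e -> exists2 r, 0 < r &
     forall h, h != 0 -> `|h| < r -> `|h^-1 * (g h - g 0) - d| <= e) ->
  is_derive (0 : R) 1 g d.
Proof.
move=> H.
have cv : h^-1 *: ((g \o shift 0) (h *: (1 : R)) - g 0) @[h --> 0^'] --> d.
  apply/cvgrPdist_le => e e0; have [r r0 h] := H e e0.
  rewrite near_withinE; apply/nbhs_ballP; exists r => //= t.
  rewrite -ball_normE /ball_ /= sub0r normrN => tr t0.
  by rewrite distrC /GRing.scale /= mulr1 addr0 h.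
by apply: DeriveDef; [apply/cvg_ex; exists d|exact: cvg_lim].
Qed.

Lemma derive0_gt0 (g : R -> R) (d : R) : is_derive (0 : R) 1 g d -> 0 < d ->
  exists2 r, 0 < r & forall t, 0 < t < r -> g 0 < g t.
Proof.
move=> [dg gd] d0.
have : h^-1 *: ((g \o shift 0) (h *: (1 : R)) - g 0) @[h --> 0^'] --> d.
  by rewrite -gd; exact: dg.
move=> /cvgrPdist_lt/(_ _ d0); rewrite near_withinE => /nbhs_ballP[r /= r0 h].
exists r => // t /andP[t0 tr].
have /(_ _ _)/= := h t; rewrite -ball_normE /ball_ /= sub0r normrN gtr0_norm//.
move=> /(_ tr); rewrite gt_eqF// => /(_ isT).
rewrite /GRing.scale /= mulr1 addr0 ltr_distlC subrr => /andP[+ _].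
by rewrite pmulr_rgt0 ?invr_gt0// subr_gt0.
Qed.

(** Only [t > 0] is tested, so this applies at a boundary point along a direction that enters the
    domain. *)
Lemma derive0_max_le0 (g : R -> R) (d r : R) : is_derive (0 : R) 1 g d -> 0 < r ->
  (forall t, 0 < t < r -> g t <= g 0) -> d <= 0.
Proof.
move=> dg r0 gmax; rewrite leNgt; apply/negP => d0.
have [s s0 gs] := derive0_gt0 dg d0.
have m0 : 0 < Num.min r s / 2 by rewrite divr_gt0// lt_min r0.
have := gs (Num.min r s / 2); have := gmax (Num.min r s / 2).
have h : Num.min r s / 2 < Num.min r s by rewrite ltr_pdivrMr// ltr_pMr ?lt_min ?r0// ltr1n.
rewrite m0 /= (lt_le_trans h) ?ge_min ?lexx// => /(_ isT) h1.
by rewrite (lt_le_trans h) ?ge_min ?lexx ?orbT// => /(_ isT); rewrite ltNge h1.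
Qed.

Lemma is_derive_continuous (g : R -> R) (s d : R) :
  is_derive s 1 g d -> {for s, continuous g}.
Proof.
move=> [dg _]; apply: differentiable_continuous.
exact/derivable1_diffP.
Qed.

Lemma MVT_cont (g dg : R -> R) (a b : R) : a < b ->
  (forall s, a <= s <= b -> is_derive s 1 g (dg s)) ->
  exists2 c, a < c < b & g b - g a = dg c * (b - a).
Proof.
move=> ab dgP; have [||c] := @MVT _ g dg a b ab.
- by move=> x; rewrite in_itv /= => /andP[x1 x2]; apply: dgP; rewrite !ltW.
- apply: continuous_in_subspaceT => s; rewrite inE /= in_itv /= => sab.
  exact: is_derive_continuous (dgP _ sab).
by rewrite in_itv /= => cab e; exists c.
Qed.

(** The sign of [b] is free, which suits the signed increments of difference quotients. *)
Lemma MVT0 (g dg : R -> R) (b : R) :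
  (forall s : R, `|s| <= `|b| -> is_derive s 1 g (dg s)) ->
  exists2 c, `|c| <= `|b| & g b - g 0 = dg c * b.
Proof.
move=> dgP; have [b0|b0|->] := ltgtP b 0.
- have [s /andP[s1 s2]|c /andP[c1 c2] e] := @MVT_cont g dg b 0 b0.
    by apply: dgP; rewrite ler0_norm// ltr0_norm// lerN2.
  exists c; first by rewrite ltr0_norm// ltr0_norm// lerN2 ltW.
  by rewrite -opprB e sub0r mulrN opprK.
- have [s /andP[s1 s2]|c /andP[c1 c2] e] := @MVT_cont g dg 0 b b0.
    by apply: dgP; rewrite ger0_norm// gtr0_norm.
  exists c; first by rewrite gtr0_norm// gtr0_norm// ltW.
  by rewrite e subr0.
- by exists 0 => //; rewrite subrr mulr0.
Qed.

(** If [d > 0], then [g1] is positive just to the right of 0, and the mean value theorem puts [g]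
    above [g 0] there. *)
Lemma second_derivative_max (g g1 : R -> R) (d r : R) : 0 < r ->
  (forall t : R, `|t| < r -> is_derive t 1 g (g1 t)) -> g1 0 = 0 ->
  is_derive (0 : R) 1 g1 d -> (forall t, `|t| < r -> g t <= g 0) -> d <= 0.
Proof.
move=> r0 dg g10 dg1 gmax; rewrite leNgt; apply/negP => d0.
have [s s0 gs] := derive0_gt0 dg1 d0.
set m := Num.min r s; have m0 : 0 < m by rewrite lt_min r0.
have mr : m <= r by rewrite ge_min lexx.
have ms : m <= s by rewrite ge_min lexx orbT.
have h : m / 2 < m by rewrite ltr_pdivrMr// ltr_pMr// ltr1n.
have h0 : 0 < m / 2 by rewrite divr_gt0.
have [t /andP[t0 tm]|c /andP[c0 cm] e] := @MVT_cont g g1 0 (m / 2) h0.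
  by apply: dg; rewrite ger0_norm// (le_lt_trans tm)// (lt_le_trans h).
have := gmax (m / 2); rewrite gtr0_norm// (lt_le_trans h)// => /(_ isT).
rewrite -subr_le0 e subr0 pmulr_lle0// leNgt -g10 gs// c0 /=.
by rewrite (lt_le_trans _ ms)// (lt_trans cm).
Qed.

Lemma is_derive_sum_fun (I : Type) (q : seq I) (F : I -> R -> R) (dF : I -> R) (t : R) :
  (forall i, is_derive t 1 (F i) (dF i)) ->
  is_derive t 1 (fun s => \sum_(i <- q) F i s) (\sum_(i <- q) dF i).
Proof.
move=> dFP; elim: q => [|i q IH].
  rewrite big_nil (_ : (fun _ => _) = cst 0); first exact: is_derive_cst.
  by apply/funext => s; rewrite big_nil.
rewrite big_cons (_ : (fun _ => _) = F i + (fun s => \sum_(j <- q) F j s)).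
  exact: is_deriveD.
by apply/funext => s; rewrite big_cons.
Qed.

Lemma is_derive_line (V : normedModType R) (f : V -> R) (y v : V) (s : R) :
  derivable f (y + s *: v) v ->
  is_derive s 1 (fun t : R => f (y + t *: v)) ('D_v f (y + s *: v)).
Proof.
have E : (fun h : R => h^-1 *: (((fun t : R => f (y + t *: v)) \o shift s) (h *: (1 : R)) -
     f (y + s *: v))) =
   (fun h : R => h^-1 *: ((f \o shift (y + s *: v)) (h *: v) - f (y + s *: v))).
  apply/funext => h; rewrite (_ : h *: (1 : R) = h); last exact: mulr1.
  by congr (_ *: (f _ - _)); rewrite /= scalerDl addrCA.
by move=> df; apply: DeriveDef; rewrite /derivable /derive /= E.
Qed.

(** * Continuous partial derivatives: lines and mixed partials *)

Section C1.
Variables (n : nat) (U : set 'rV[R]_n).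
Hypothesis oU : open U.

Definition C1On (f : 'rV[R]_n -> R) := forall i x, U x ->
  derivable f x (evec R i) /\ {for x, continuous ('D_(evec R i) f)}.

Lemma norm_evec_le (i : 'I_n) : `|evec R i| <= 1.
Proof.
apply: mx_norm_le_coord => // a b; rewrite mxE.
by case: (_ && _); rewrite ?normr1 ?normr0 ?ler01.
Qed.

Lemma norm_scale_evec (s : R) (i : 'I_n) : `|s *: evec R i| <= `|s|.
Proof. by rewrite normrZ ler_piMr ?norm_evec_le. Qed.

(** One coordinate direction is added at a time. The mean value theorem turns the extra increment
    into [h * c] times the partial derivative at a nearby point, and continuity of that partial
    derivative gives the limit. *)
Lemma is_derive_add_dir (f : 'rV[R]_n -> R) x v i c d : C1On f -> U x ->
  is_derive (0 : R) 1 (fun t : R => f (x + t *: v)) d ->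
  is_derive (0 : R) 1 (fun t : R => f (x + t *: (v + c *: evec R i))) (d + c * 'D_(evec R i) f x).
Proof.
move=> C1 Ux dv.
suff H : is_derive (0 : R) 1 (fun t : R => f (x + t *: (v + c *: evec R i)) - f (x + t *: v))
    (c * 'D_(evec R i) f x).
  rewrite (_ : (fun _ => _) = (fun t : R => f (x + t *: v)) +
      (fun t : R => f (x + t *: (v + c *: evec R i)) - f (x + t *: v))).
    exact: is_deriveD.
  by apply/funext => t /=; rewrite !fctE addrC subrK.
apply: is_derive0P => e e0; rewrite !scale0r !addr0 subrr.
have [r1 r10 Ur1] := open_normP oU Ux.
have c1 : 0 < `|c| + 1 by rewrite ltr_wpDl.
have [r2 r20 Dr2] := continuous_normP (C1 i x Ux).2 (divr_gt0 e0 c1).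
set r := Num.min r1 r2; have r0 : 0 < r by rewrite lt_min r10.
(* [|h| * K] bounds every displacement [h v + s e_i] with [|s| <= |h c|]. *)
set K := `|v| + `|c| + 1; have K0 : 0 < K by rewrite ltr_wpDl// addr_ge0.
exists (r / K); first by rewrite divr_gt0.
move=> h h0; rewrite ltr_pdivlMr// => hK.
have close s : `|s| <= `|h * c| -> `|(x + h *: v + s *: evec R i) - x| < r.
  move=> sh; apply: le_lt_trans hK.
  rewrite add3BK (le_trans (ler_normD _ _))// /K mulrDr mulrDr -addrA lerD//.
    by rewrite normrZ.
  rewrite (le_trans (norm_scale_evec _ _))// (le_trans sh)// normrM.
  by rewrite lerDl mulr1.
have [s sh|s sh] := @MVT0 (fun s : R => f (x + h *: v + s *: evec R i))
   (fun s => 'D_(evec R i) f (x + h *: v + s *: evec R i)) (h * c).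
  apply: is_derive_line; apply: (C1 i _ _).1; apply: Ur1.
  by apply: lt_le_trans (close _ sh) _; rewrite ge_min lexx.
rewrite scale0r addr0 scalerDr scalerA addrA => ->.
set D := 'D_ _ f (_ + _); set D0 := 'D_ _ f x.
have -> : h^-1 * (D * (h * c) - 0) - c * D0 = c * (D - D0) by field.
rewrite normrM.
rewrite (le_trans (_ : _ <= `|c| * (e / (`|c| + 1))))//.
  rewrite ler_wpM2l// ltW// Dr2//.
  by apply: lt_le_trans (close _ sh) _; rewrite ge_min lexx orbT.
by rewrite mulrCA ger_pMr// ler_pdivrMr// mul1r lerDl.
Qed.

Lemma is_derive_C1_line0 (f : 'rV[R]_n -> R) x v : C1On f -> U x ->
  is_derive (0 : R) 1 (fun t : R => f (x + t *: v)) (\sum_i v 0 i * 'D_(evec R i) f x).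
Proof.
move=> C1 Ux.
rewrite [in X in is_derive _ _ X _](_ : v = \sum_i v 0 i *: evec R i); last first.
  exact: row_sum_delta.
elim: (index_enum _) => [|i q IH].
  rewrite !big_nil (_ : (fun _ => _) = cst (f x)); first exact: is_derive_cst.
  by apply/funext => t; rewrite scaler0 addr0.
rewrite [X in is_derive _ _ _ X]big_cons [X in is_derive _ _ _ X]addrC.
rewrite [X in is_derive _ _ X _](_ : _ = fun t : R =>
    f (x + t *: (\sum_(j <- q) v 0 j *: evec R j + v 0 i *: evec R i))).
  exact: is_derive_add_dir.
by apply/funext => t; rewrite big_cons; congr (f (_ + _ *: _)); exact: addrC.
Qed.

Lemma is_derive_C1_line (f : 'rV[R]_n -> R) x v s : C1On f -> U (x + s *: v) ->
  is_derive s 1 (fun t : R => f (x + t *: v))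
    (\sum_i v 0 i * 'D_(evec R i) f (x + s *: v)).
Proof.
move=> C1 Ux; have [h1 h2] := is_derive_C1_line0 v C1 Ux.
have E : (fun h : R => h^-1 *: (((fun t : R => f (x + s *: v + t *: v)) \o shift 0) (h *: (1 : R)) -
     f (x + s *: v + 0 *: v))) =
   (fun h : R => h^-1 *: (((fun t : R => f (x + t *: v)) \o shift s) (h *: (1 : R)) - f (x + s *: v))).
  apply/funext => h; rewrite (_ : h *: (1 : R) = h); last exact: mulr1.
  rewrite scale0r addr0; congr (_ *: (f _ - _)).
  by rewrite /= addr0 scalerDl -addrA [s *: v + _]addrC.
by move: h1 h2; rewrite /derivable /derive /= E => h1 h2; exact: DeriveDef.
Qed.

(** Two mean value steps: first along [e_i] for the increment of [f] in [e_j], then along [e_j] for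
    its derivative in [e_i]. *)
Lemma second_difference (f : 'rV[R]_n -> R) x i j h :
  C1On f -> C1On ('D_(evec R i) f) ->
  (forall s t : R, `|s| <= `|h| -> `|t| <= `|h| -> U (x + s *: evec R i + t *: evec R j)) ->
  exists s t : R, [/\ `|s| <= `|h|, `|t| <= `|h| &
    f (x + h *: evec R i + h *: evec R j) - f (x + h *: evec R i) - f (x + h *: evec R j) + f x =
    'D_(evec R j) ('D_(evec R i) f) (x + s *: evec R i + t *: evec R j) * h * h].
Proof.
move=> Cf CDf Uh.
have h0 : `|0 : R| <= `|h| by rewrite normr0.
have [s sh|s sh es] := @MVT0
   (fun s : R => f (x + h *: evec R j + s *: evec R i) - f (x + s *: evec R i))
   (fun s => 'D_(evec R i) f (x + h *: evec R j + s *: evec R i) -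
             'D_(evec R i) f (x + s *: evec R i)) h.
  apply: is_deriveB; apply: is_derive_line; apply: (Cf i _ _).1.
    by rewrite addrAC; exact: Uh.
  by have := Uh _ _ sh h0; rewrite scale0r addr0.
have [t th|t th et] := @MVT0
   (fun t : R => 'D_(evec R i) f (x + s *: evec R i + t *: evec R j))
   (fun t => 'D_(evec R j) ('D_(evec R i) f) (x + s *: evec R i + t *: evec R j)) h.
  by apply: is_derive_line; apply: (CDf j _ _).1; exact: Uh.
exists s, t; split => //; rewrite -et scale0r addr0.
rewrite [x + s *: _ + _]addrAC -es scale0r !addr0.
rewrite [x + h *: evec R i + _]addrAC; ring.
Qed.

(** The second difference is symmetric in [i] and [j], so the two mixed derivatives share a value
    [c] at nearby points. By continuity [c] lies within half of [|a - b|] of both [a] and [b], which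
    is absurd. *)
Lemma mixed_partials (f : 'rV[R]_n -> R) x i j :
  C1On f -> (forall k, C1On ('D_(evec R k) f)) -> U x ->
  'D_(evec R j) ('D_(evec R i) f) x = 'D_(evec R i) ('D_(evec R j) f) x.
Proof.
move=> Cf CDf Ux; apply/eqP; rewrite -subr_eq0 -normr_le0 leNgt; apply/negP => d0.
set a := 'D_ _ _ x in d0 *; set b := 'D_(evec R i) _ x in d0 *.
have [r0 r00 Ur0] := open_normP oU Ux.
have e0 : 0 < `|a - b| / 2 by rewrite divr_gt0.
have [r1 r10 Dr1] := continuous_normP (CDf i j x Ux).2 e0.
have [r2 r20 Dr2] := continuous_normP (CDf j i x Ux).2 e0.
set r := Num.min r0 (Num.min r1 r2); have r_gt0 : 0 < r by rewrite !lt_min r00 r10.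
have rr0 : r <= r0 by rewrite ge_min lexx.
have rr1 : r <= r1 by rewrite !ge_min lexx orbT.
have rr2 : r <= r2 by rewrite !ge_min lexx !orbT.
(* Two displacements of size at most [r / 3] stay strictly inside the ball of radius [r]. *)
pose h := r / 3; have h0 : 0 < h by rewrite divr_gt0.
have close k l s t : `|s| <= `|h| -> `|t| <= `|h| ->
    `|(x + s *: evec R k + t *: evec R l) - x| < r.
  rewrite (gtr0_norm h0) => sh th; rewrite add3BK.
  apply: le_lt_trans (ler_normD _ _) _.
  have := norm_scale_evec s k; have := norm_scale_evec t l; rewrite /h in sh th *; lra.
have Uc k l s t (sh : `|s| <= `|h|) (th : `|t| <= `|h|) :
    U (x + s *: evec R k + t *: evec R l).
  by apply: Ur0; exact: lt_le_trans (close _ _ _ _ sh th) rr0.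
have [s [t [sh th e1]]] := second_difference Cf (CDf i) (Uc i j).
have [s' [t' [sh' th' e2]]] := second_difference Cf (CDf j) (Uc j i).
have := Dr1 _ (lt_le_trans (close i j _ _ sh th) rr1).
have := Dr2 _ (lt_le_trans (close j i _ _ sh' th') rr2).
rewrite -/a -/b.
have -> : 'D_(evec R i) ('D_(evec R j) f) (x + s' *: evec R j + t' *: evec R i) =
          'D_(evec R j) ('D_(evec R i) f) (x + s *: evec R i + t *: evec R j).
  have L : f (x + h *: evec R j + h *: evec R i) - f (x + h *: evec R j)
      - f (x + h *: evec R i) + f x =
    f (x + h *: evec R i + h *: evec R j) - f (x + h *: evec R i)
      - f (x + h *: evec R j) + f x.
    by congr (_ + _); rewrite [LHS]addrAC; congr (f _ - _ - _); exact: addrAC.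
  have h_neq0 : h != 0 by rewrite gt_eqF.
  exact: (mulIf h_neq0 (mulIf h_neq0 (etrans (esym e2) (etrans L e1)))).
set c := 'D_ _ _ (_ + _ + _).
move: a b c d0 {e0 Dr1 Dr2 e1 e2 Cf CDf Uc} => a b c d0; rewrite !ltr_distl => /andP[h1 h2] /andP[h3 h4].
have : `|a - b| < `|a - b| by rewrite {1}ltr_norml; lra.
by rewrite ltxx.
Qed.

End C1.

End Calculus.

(** * C2 functions *)

Section C2.
Variables (R : realType) (n : nat).
Implicit Types (U : set 'rV[R]_n) (u w : 'rV[R]_n -> R) (x v : 'rV[R]_n).

Lemma CkOn_C1On U u k : CkOn k U u -> (0 < k)%N -> C1On U u.
Proof.
move=> Cu k0 i x Ux; split.
  by have [_ /(_ k0 i x Ux)] := Cu [::] isT.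
by have [/(_ x Ux)] := Cu [:: i] k0.
Qed.

Lemma CkOn_deriv_C1On U u i : CkOn 2 U u -> C1On U ('D_(evec R i) u).
Proof.
move=> Cu j x Ux; split.
  by have [_ /(_ isT j x Ux)] := Cu [:: i] isT.
by have [/(_ x Ux)] := Cu [:: j; i] isT.
Qed.

Lemma CkOn_continuous U u k x : CkOn k U u -> U x -> {for x, continuous u}.
Proof. by move=> Cu Ux; have [/(_ x Ux)] := Cu [::] isT. Qed.

Lemma hess_sym U u x : open U -> CkOn 2 U u -> U x -> sym_mx (hess u x).
Proof.
move=> oU Cu Ux; apply/matrixP => i j; rewrite !mxE.
apply: (mixed_partials oU) => //; first exact: CkOn_C1On Cu isT.
by move=> k; exact: CkOn_deriv_C1On.
Qed.

Lemma is_deriveM_fun (f g : R -> R) (t df dg : R) :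
  is_derive t 1 f df -> is_derive t 1 g dg ->
  is_derive t 1 (fun s : R => f s * g s) (f t * dg + g t * df).
Proof. by move=> dF dG; exact: is_deriveM. Qed.

Lemma is_derive_sqr (g : R -> R) (t d : R) : is_derive t 1 g d ->
  is_derive t 1 (fun s : R => g s ^+ 2) (2 * (g t * d)).
Proof.
move=> dg; rewrite (_ : (fun _ => _) = fun s : R => g s * g s); last first.
  by apply/funext => s; rewrite expr2.
apply: (is_derive_eq (is_deriveM_fun dg dg)).
by rewrite mulr_natl mulr2n.
Qed.

Lemma is_derive_line2 U u x v : open U -> CkOn 2 U u -> U x ->
  is_derive (0 : R) 1 (fun t : R => \sum_i v 0 i * 'D_(evec R i) u (x + t *: v))
    (qform (hess u x) v).
Proof.
move=> oU Cu Ux; rewrite qformE exchange_big /=.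
apply: is_derive_sum_fun => i.
have D := is_derive_C1_line0 oU v (CkOn_deriv_C1On i Cu) Ux.
apply: (is_derive_eq (is_deriveM_fun (is_derive_cst (v 0 i) _ _) D)).
rewrite mulr0 addr0 mulr_sumr; apply: eq_bigr => j _.
by rewrite mxE mulrC.
Qed.

Lemma qdot_grad u x v : qdot v (grad u x) = \sum_i v 0 i * 'D_(evec R i) u x.
Proof. by rewrite qdotE; apply: eq_bigr => i _; rewrite mxE. Qed.

(** First and second derivative tests for [u - w] along every line through [x]; the gradients agree
    on testing with their own difference. *)
Lemma touching_above U u w x r : open U -> CkOn 2 U u -> CkOn 2 U w -> U x -> 0 < r ->
  (forall y, `|y - x| < r -> u y - w y <= u x - w x) ->
  grad u x = grad w x /\ forall v, qform (hess u x) v <= qform (hess w x) v.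
Proof.
move=> oU Cu Cw Ux r0 umax.
have [r1 r10 Ur1] := open_normP oU Ux.
have C1u := CkOn_C1On Cu isT; have C1w := CkOn_C1On Cw isT.
set m := Num.min r r1; have m0 : 0 < m by rewrite lt_min r0.
have mr : m <= r by rewrite ge_min lexx.
have mr1 : m <= r1 by rewrite ge_min lexx orbT.
have small v (t : R) : `|t| < m / (`|v| + 1) -> `|x + t *: v - x| < m.
  rewrite ltr_pdivlMr ?ltr_wpDl// => tm; apply: le_lt_trans tm.
  by rewrite addrC addKr normrZ ler_wpM2l// lerDl.
have dm v : 0 < m / (`|v| + 1) by rewrite divr_gt0// ltr_wpDl.
have dline v (t : R) : `|t| < m / (`|v| + 1) ->
    is_derive t 1 (fun t : R => u (x + t *: v) - w (x + t *: v))
      (\sum_i v 0 i * 'D_(evec R i) u (x + t *: v) - \sum_i v 0 i * 'D_(evec R i) w (x + t *: v)).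
  move=> tm; have Uxt : U (x + t *: v).
    by apply: Ur1; apply: lt_le_trans mr1; exact: small.
  by apply: is_deriveB; exact: (is_derive_C1_line oU).
have maxline v (t : R) : `|t| < m / (`|v| + 1) ->
    u (x + t *: v) - w (x + t *: v) <= u (x + 0 *: v) - w (x + 0 *: v).
  rewrite scale0r addr0 => tm; apply: umax; apply: lt_le_trans mr; exact: small.
have g0 v : qdot v (grad u x - grad w x) <= 0.
  have := @derive0_max_le0 R _ _ (m / (`|v| + 1)) (dline v 0 _) (dm v).
  rewrite normr0 scale0r addr0 -!qdot_grad => /(_ (dm v)) h.
  have -> : qdot v (grad u x - grad w x) = qdot v (grad u x) - qdot v (grad w x).
    by rewrite qdotDr -scaleN1r qdotZr mulN1r.
  apply: h => t /andP[t0 tm]; have := maxline v t.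
  by rewrite scale0r addr0 gtr0_norm//; apply.
have e : grad u x = grad w x.
  apply/eqP; rewrite -subr_eq0 -qdotvv_eq0; apply/eqP/le_anti.
  by rewrite g0 qdotvv_ge0.
split=> [|v]; first exact: e.
rewrite -subr_le0.
apply: (second_derivative_max (dm v) (dline v)) (maxline v).
  by rewrite scale0r addr0 -!qdot_grad e subrr.
apply: is_deriveB; first exact: (is_derive_line2 v oU Cu Ux).
exact: (is_derive_line2 v oU Cw Ux).
Qed.

(** Moving along the gradient itself makes the derivative of [|Du|^2] equal to [2 D^2u(p, p)], a
    term that the lower bounds on [omega] and [A] control. *)
Lemma is_derive_grad_expR U u x (c : R) : open U -> CkOn 2 U u -> U x ->
  let p := grad u x in
  is_derive (0 : R) 1
    (fun t : R => qdot (grad u (x + t *: p)) (grad u (x + t *: p)) * expR (c * u (x + t *: p)))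
    (expR (c * u x) * (2 * qform (hess u x) p + c * qdot p p ^+ 2)).
Proof.
move=> oU Cu Ux p.
have C1u := CkOn_C1On Cu isT.
have d1 : is_derive (0 : R) 1 (fun t : R => qdot (grad u (x + t *: p)) (grad u (x + t *: p)))
    (2 * qform (hess u x) p).
  rewrite (_ : (fun _ => _) =
      fun t : R => \sum_i ('D_(evec R i) u (x + t *: p)) ^+ 2); last first.
    by apply/funext => t; rewrite qdotE; apply: eq_bigr => i _; rewrite mxE expr2.
  rewrite qformE exchange_big mulr_sumr; apply: is_derive_sum_fun => i.
  have D := is_derive_C1_line0 oU p (CkOn_deriv_C1On i Cu) Ux.
  apply: (is_derive_eq (is_derive_sqr D)).
  rewrite scale0r addr0; congr (2 * _); rewrite mulr_sumr; apply: eq_bigr => j _.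
  by rewrite [hess u x j i]mxE [p 0 i]mxE mulrC.
have d2 : is_derive (0 : R) 1 (fun t : R => expR (c * u (x + t *: p)))
    (expR (c * u x) * (c * qdot p p)).
  have D := is_derive_C1_line0 oU p C1u Ux.
  have cD := is_deriveM_fun (is_derive_cst c _ _) D.
  apply: (is_derive_eq (is_derive1_comp (is_derive_expR _) cD)).
  rewrite scale0r addr0 -qdot_grad -/p; congr (_ * _).
  by rewrite mulr0 addr0.
apply: (is_derive_eq (is_deriveM_fun d1 d2)).
by rewrite !scale0r !addr0 -/p; ring.
Qed.

Lemma continuous_qdot_grad U u x : CkOn 2 U u -> U x ->
  {for x, continuous (fun y => qdot (grad u y) (grad u y))}.
Proof.
move=> Cu Ux.
rewrite (_ : (fun _ => _) = fun y => \sum_i 'D_(evec R i) u y * 'D_(evec R i) u y).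
  apply: continuous_sum_fun => i; have ci := (CkOn_C1On Cu isT i Ux).2.
  exact: (continuousM ci ci).
by apply/funext => y; rewrite qdotE; apply: eq_bigr => i _; rewrite !mxE.
Qed.

(** Farkas' lemma for one open half-space. Let [G'] be the component of [G] orthogonal to [r];
    testing with [- G' - e r] gives [|G'|^2 <= - e (G . r)] for all [e > 0], so [G' = 0]. *)
Lemma half_space_dual (G r : 'rV[R]_n) : r != 0 ->
  (forall v, qdot r v < 0 -> 0 <= qdot G v) -> exists2 c : R, 0 <= c & G = - c *: r.
Proof.
move=> r0 H; have rr : 0 < qdot r r by rewrite lt0r qdotvv_eq0 r0 qdotvv_ge0.
pose c := - (qdot G r / qdot r r).
have Gr : qdot G r <= 0.
  have := H (- 1 *: r); rewrite !qdotZr !mulN1r oppr_lt0 rr => /(_ isT).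
  by rewrite oppr_ge0.
exists c; first by rewrite oppr_ge0 pmulr_lle0// invr_gt0.
pose G' := G + c *: r.
have G'r : qdot G' r = 0 by rewrite qdotDl qdotZl /c; field; rewrite gt_eqF.
have GG' : qdot G G' = qdot G' G'.
  by rewrite [in RHS]/G' qdotDl qdotZl [qdot r _]qdotC G'r mulr0 addr0.
have le e : 0 < e -> qdot G' G' <= - qdot G r * e.
  move=> e0; have := H ((- 1) *: G' + (- e) *: r).
  have -> : qdot r (-1 *: G' + - e *: r) = - (e * qdot r r).
    by rewrite qdotDr !qdotZr [qdot r G']qdotC G'r mulr0 add0r mulNr.
  have -> : qdot G (-1 *: G' + - e *: r) = - qdot G' G' - e * qdot G r.
    by rewrite qdotDr !qdotZr GG' mulN1r mulNr.
  rewrite oppr_lt0 mulr_gt0// => /(_ isT).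
  move: (qdot G' G') (qdot G r) => a b; lra.
suff G'0 : G' = 0 by apply/eqP; rewrite scaleNr -addr_eq0; apply/eqP.
apply/eqP; rewrite -qdotvv_eq0 eq_le qdotvv_ge0 andbT leNgt; apply/negP => s0.
(* This denominator makes [e] small enough and stays positive when [qdot G r = 0]. *)
have d0 : 0 < 2 * (1 - qdot G r) by rewrite mulr_gt0// subr_gt0 (le_lt_trans Gr).
have := le (qdot G' G' / (2 * (1 - qdot G r))) (divr_gt0 s0 d0).
rewrite mulrCA ler_pMr// ler_pdivlMr// mul1r.
move: Gr; lra.
Qed.

(** A direction of strict decrease of [rho] enters [Om] because [rho x0 <= 0]: otherwise [rho] would
    be positive near [x0], where [Om] has points. *)
Lemma boundary_inward Om (rho : 'rV[R]_n -> R) x0 r v : 0 < r -> closure Om x0 ->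
  CkOn 1 (ball x0 r) rho -> (forall x, ball x0 r x -> (Om x <-> rho x < 0)) ->
  qdot (grad rho x0) v < 0 ->
  exists2 e : R, 0 < e & forall t, 0 < t < e -> Om (x0 + t *: v).
Proof.
move=> r0 clx Cr Omr gv.
have oB : open (ball x0 r) by exact: ball_open.
have Bx : ball x0 r x0 by exact: ballxx.
have rx0 : rho x0 <= 0.
  rewrite leNgt; apply/negP => rp.
  have [s s0 Hs] := continuous_normP (CkOn_continuous Cr Bx) rp.
  have [|y [Oy [sy ry]]] := clx (ball x0 s `&` ball x0 r).
    by apply: filterI; exact: nbhsx_ballx.
  have := (Omr y ry).1 Oy; have := Hs y.
  move: sy; rewrite -ball_normE /ball_ /= distrC => sy /(_ sy).
  by rewrite ltr_distl subrr => /andP[/lt_trans h _] /h; rewrite ltxx.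
have := is_derive_C1_line0 oB v (CkOn_C1On Cr isT) Bx.
move=> /is_deriveN; rewrite -qdot_grad qdotC => dv.
have [|s s0 Hs] := derive0_gt0 dv; first by rewrite oppr_gt0.
have V0 : 0 < `|v| + 1 by rewrite ltr_wpDl.
exists (Num.min s (r / (`|v| + 1))); first by rewrite lt_min s0 divr_gt0.
move=> t; rewrite lt_min ltr_pdivlMr// => /and3P[t0 ts tr].
apply/Omr.
  rewrite -ball_normE /ball_ /= opprD addNKr normrN normrZ gtr0_norm//.
  by apply: le_lt_trans tr; rewrite ler_pM2l// lerDl.
have := Hs t; rewrite t0 ts => /(_ isT) /=; rewrite !fctE ltrN2 scale0r addr0.
by move=> /lt_le_trans; apply.
Qed.

End C2.

(** * Functions on the closed domain *)

Section Domain.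
Variables (R : realType) (n : nat).
Implicit Types (Om U : set 'rV[R]_n) (u : 'rV[R]_n -> R) (x v p : 'rV[R]_n).

Lemma CkOn_subset k (m : nat) (U V : set 'rV[R]_m) (f : 'rV[R]_m -> R) :
  V `<=` U -> CkOn k U f -> CkOn k V f.
Proof.
move=> VU Cf l lk; have [h1 h2] := Cf l lk; split=> [x /VU|lk' i x /VU]; first exact: h1.
exact: h2.
Qed.

Lemma CkOn_cst0 k U : CkOn k U (fun=> 0 : R).
Proof.
have E l : dpart l (fun=> 0) = (fun=> 0) :> ('rV[R]_n -> R).
  elim: l => //= i l ->; apply/funext => x; exact: derive_cst.
move=> l _; rewrite E; split=> [x _|_ i x _]; first exact: cst_continuous.
exact: derivable_cst.
Qed.

Lemma compact_bound (T : topologicalType) (K : set T) (f : T -> R) : compact K ->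
  (forall x : T, K x -> {for x, continuous f}) ->
  exists2 C : R, 0 <= C & forall x : T, K x -> `|f x| <= C.
Proof.
move=> cK cf; have [->|K0] := eqVneq K set0; first by exists 0.
have cn : {within K, continuous (fun x : T => `|f x|)}.
  apply: continuous_in_subspaceT => x; rewrite inE => Kx.
  by apply: (@continuous_comp _ _ _ f Num.norm); [exact: cf|exact: norm_continuous].
have [|c _ cmax] := compact_EVT_max _ cK cn; first exact/set0P.
by exists `|f c| => // x Kx; apply: cmax; rewrite inE.
Qed.

Lemma compact_max (T : topologicalType) (K : set T) (f : T -> R) : compact K -> K !=set0 ->
  (forall x : T, K x -> {for x, continuous f}) ->
  exists2 c, K c & forall x : T, K x -> f x <= f c.
Proof.
move=> cK K0 cf.
have cn : {within K, continuous f}.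
  by apply: continuous_in_subspaceT => x; rewrite inE; exact: cf.
have [c] := compact_EVT_max K0 cK cn; rewrite inE => Kc cmax.
by exists c => // x Kx; apply: cmax; rewrite inE.
Qed.

Lemma bounded_set_compact_closure Om (M : R) : (forall x, Om x -> vnorm x <= M) ->
  compact (closure Om).
Proof.
move=> OmM; apply: bounded_closed_compact; last exact: closed_closure.
have sub : closure Om `<=` [set x | `|x| <= `|M|].
  suff cl : closed [set x : 'rV[R]_n | `|x| <= `|M|].
    rewrite [X in _ `<=` X](closure_id _).1//.
    apply: closure_subset => x Ox /=; apply: mx_norm_le_coord => // i j; rewrite ord1.
    rewrite -[leLHS]ger0_norm// -ler_sqr ?nnegrE// normr_id !real_normK ?num_real//.
    apply: le_trans (sqr_coord_le_qdot _ _) _; rewrite -vnorm_sqr.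
    by rewrite ler_sqr ?nnegrE ?vnorm_ge0 ?OmM// (le_trans _ (OmM _ Ox)) ?vnorm_ge0.
  apply: (@preimage_closed _ _ (fun x : 'rV[R]_n => `|x|) [set t | t <= `|M|]).
    by move=> x _; exact: norm_continuous.
  exact: closed_le.
exists `|M|; split=> // t Mt x /sub /= xM; exact: le_trans (ltW Mt).
Qed.

(** [inf] is 0 by default on sets without an infimum, so a positive value certifies a genuine lower
    bound. *)
Lemma inf_gt0_le (E : set R) y : 0 < inf E -> E y -> inf E <= y.
Proof.
move=> E0 Ey; apply: ge_inf => //.
suff [] : has_inf E by [].
by apply: contrapT => /inf_out E00; rewrite E00 ltxx in E0.
Qed.

Implicit Types (F : 'rV[R]_n -> R -> 'rV[R]_n -> R).

Lemma packD_row F x z p : packD F (row_mx x (row_mx z%:M p)) = F x z p.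
Proof. by rewrite /packD !row_mxKl !row_mxKr row_mxKl mxE eqxx mulr1n. Qed.

Lemma CkD_is_derive F Om k x (z : R) p : CkD k Om F -> (0 < k)%N -> closure Om x ->
  is_derive z 1 (fun t : R => F x t p) (Dz F x z p).
Proof.
move=> [U [oU [SU CU]]] k0 Ox.
pose i : 'I_(n + (1 + n)) := rshift n (lshift n 0).
have E t : row_mx x (row_mx 0 p) + t *: evec R i = row_mx x (row_mx t%:M p).
  have -> : evec R i = row_mx 0 (row_mx 1%:M 0).
    apply/rowP => j; rewrite -[j]splitK; case: (fintype.split j) => a /=.
      by rewrite row_mxEl !mxE eq_lrshift.
    rewrite row_mxEr -[a]splitK; case: (fintype.split a) => b /=.
      by rewrite row_mxEl !mxE eq_rshift eq_lshift ord1 eqxx.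
    by rewrite row_mxEr !mxE eq_rshift eq_rlshift.
  rewrite !scale_row_mx !add_row_mx !scaler0 !addr0 add0r.
  by rewrite scale_scalar_mx mulr1.
have fE : (fun t : R => F x t p) =
    (fun t : R => packD F (row_mx x (row_mx 0 p) + t *: evec R i)).
  by apply/funext => t; rewrite E packD_row.
rewrite /Dz derive1E; apply/derivableP; rewrite fE.
have [|d _] := @is_derive_line R _ (packD F) (row_mx x (row_mx 0 p)) (evec R i) z.
  rewrite E; have [_ h] := CU [::] isT.
  by apply: (h k0 i); apply: SU; rewrite /setD_ /= row_mxKl.
exact: d.
Qed.

Lemma CkD_Dz_mono F Om k x p : CkD k Om F -> (0 < k)%N -> closure Om x ->
  (forall z, 0 < Dz F x z p) -> forall z z', z < z' -> F x z p < F x z' p.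
Proof.
move=> CF k0 Ox DF z z' zz'.
have [t _|c _ e] := @MVT_cont R (fun t => F x t p) (fun t => Dz F x t p) z z' zz'.
  exact: CkD_is_derive CF k0 Ox.
by rewrite -subr_gt0 e mulr_gt0// subr_gt0.
Qed.

Lemma mxCkD_qform_mono (A : 'rV[R]_n -> R -> 'rV[R]_n -> 'M[R]_n) Om k x p :
  mxCkD k Om A -> (0 < k)%N -> closure Om x ->
  (forall z, mx_ge_scalar (mxDz A x z p) 0) ->
  forall v z z', z <= z' -> qform (A x z p) v <= qform (A x z' p) v.
Proof.
move=> CA k0 Ox DA v z z'; rewrite le_eqVlt => /predU1P[->//|zz'].
have [t _|c _ e] := @MVT_cont R (fun t => qform (A x t p) v) (fun t => qform (mxDz A x t p) v) z z' zz'.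
  rewrite (_ : (fun t => _) = fun t : R => \sum_i \sum_j (v 0 i * v 0 j) * A x t p i j); last first.
    apply/funext => s; rewrite qformE; apply: eq_bigr => i _; apply: eq_bigr => j _.
    by rewrite mulrAC.
  rewrite qformE; apply: is_derive_sum_fun => i; apply: is_derive_sum_fun => j.
  have D := CkD_is_derive t p (CA i j) k0 Ox.
  apply: (is_derive_eq (is_deriveM_fun (is_derive_cst (v 0 i * v 0 j) _ _) D)).
  by rewrite mulr0 addr0 mxE /= mulrAC.
rewrite -subr_ge0 e mulr_ge0//; last by rewrite subr_ge0 ltW.
by have := DA c v; rewrite mul0r.
Qed.

(** Bounds [A] and [f] at [(x, u, Du)] by a constant that sees [u] only through the size [M] of [u]
    and [Du]. *)
Lemma CkD_bounded F Om k (M : R) : compact (closure Om) -> CkD k Om F ->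
  exists2 C : R, 0 <= C & forall x z p, closure Om x -> `|z| <= M ->
    (forall i, `|p 0 i| <= M) -> `|F x z p| <= C.
Proof.
move=> cO [U [oU [SU CU]]].
pose K := [set w : 'rV[R]_(n + (1 + n)) | closure Om (lsubmx w)] `&`
  [set w | `|rsubmx w| <= `|M|].
have clK : closed K.
  apply: closedI.
    apply: (@preimage_closed _ _ (@lsubmx R 1 n (1 + n)) (closure Om)).
      by move=> w _; exact: continuous_lsubmx.
    exact: closed_closure.
  apply: (@preimage_closed _ _ (fun w : 'rV[R]_(n + (1 + n)) => `|rsubmx w|) [set t | t <= `|M|]).
    move=> w _; apply: (@continuous_comp _ _ _ (@rsubmx R 1 n (1 + n)) Num.norm).
      exact: continuous_rsubmx.
    exact: norm_continuous.
  exact: closed_le.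
have [C1 C10 C1P] := compact_bound cO (fun x _ => @norm_continuous _ _ x).
have [C C0 CP] : exists2 C : R, 0 <= C & forall w, K w -> `|packD F w| <= C.
  apply: compact_bound; last first.
    by move=> w [Kw _]; apply: (CkOn_continuous CU); exact: SU.
  apply: bounded_closed_compact => //.
  exists (C1 + `|M|); split; first exact: num_real.
  move=> t tM w [w1 w2]; apply: le_trans (ltW tM); apply: mx_norm_le_coord.
    by rewrite addr_ge0.
  move=> i j; rewrite -(hsubmxK w) -[j]splitK; case: (fintype.split j) => a /=.
    by rewrite row_mxEl (le_trans (coord_le_norm _ _ _))// -normr_id (le_trans (C1P _ w1))// lerDl normr_ge0.
  rewrite row_mxEr (le_trans (coord_le_norm _ _ _))// (le_trans w2)//.
  by rewrite lerDr.
exists C => // x z p Ox zM pM; rewrite -packD_row; apply: CP; split.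
  by rewrite /= row_mxKl.
rewrite /= row_mxKr; apply: mx_norm_le_coord => // i j.
rewrite -[j]splitK; case: (fintype.split j) => a /=.
  by rewrite row_mxEl !ord1 mxE eqxx mulr1n (le_trans zM)// ler_norm.
by rewrite row_mxEr ord1 (le_trans (pM a))// ler_norm.
Qed.

Lemma mxCkD_bounded (A : 'rV[R]_n -> R -> 'rV[R]_n -> 'M[R]_n) Om k (M : R) :
  compact (closure Om) -> mxCkD k Om A ->
  exists2 C : R, 0 <= C & forall x z p i j, closure Om x -> `|z| <= M ->
    (forall l, `|p 0 l| <= M) -> `|A x z p i j : R| <= C.
Proof.
move=> cO CA; have /choice[G GP] : forall ij : 'I_n * 'I_n, exists C : R,
    forall x z p, closure Om x -> `|z| <= M -> (forall l, `|p 0 l| <= M) ->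
    `|A x z p ij.1 ij.2| <= C.
  by move=> ij; have [C _ CP] := CkD_bounded M cO (CA ij.1 ij.2); exists C.
exists (\sum_ij `|G ij|); first by rewrite sumr_ge0.
move=> x z p i j Ox zM pM; apply: le_trans (GP (i, j) x z p Ox zM pM) _.
apply: le_trans (ler_norm _) _.
by rewrite (bigD1 (i, j))//= lerDl sumr_ge0.
Qed.

End Domain.

(** * A priori estimates *)

Section Estimates.
Variables (R : realType) (n : nat) (Om : set 'rV[R]_n).
Variable A : 'rV[R]_n -> R -> 'rV[R]_n -> 'M[R]_n.
Hypotheses (n0 : (0 < n)%N) (oOm : open Om) (cOm : compact (closure Om)).
Hypothesis Om0 : Om !=set0.
Hypothesis Asym : forall x z p, closure Om x -> sym_mx (A x z p).
Implicit Types (u : 'rV[R]_n -> R) (x v p : 'rV[R]_n).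

Local Notation Cl := (closure Om).
Local Notation bd := (closure Om `\` Om).

Lemma lambda_u_le u x : 0 < lambda_u Om A u -> Cl x -> 0 < lmin (omega A u x).
Proof.
move=> l0 Ox; apply: (lt_le_trans l0); apply: inf_gt0_le => //.
by exists x.
Qed.

Lemma gamma_u_le gt u x : 0 < gt -> 0 < lambda_u Om A u -> gt <= gamma_u Om A u -> Cl x ->
  lmax (omega A u x) <= lmin (omega A u x) / gt.
Proof.
move=> g0 l0 gl Ox; have lx := lambda_u_le l0 Ox.
have h : gt <= lmin (omega A u x) / lmax (omega A u x).
  apply: (le_trans gl); apply: inf_gt0_le; first exact: lt_le_trans gl.
  by exists x.
have L0 : 0 < lmax (omega A u x).
  by have := lt_le_trans g0 h; rewrite pmulr_rgt0// invr_gt0.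
by rewrite ler_pdivlMr// mulrC -ler_pdivlMr.
Qed.

Lemma omega_sym u U x : open U -> Cl `<=` U -> CkOn 2 U u -> Cl x -> sym_mx (omega A u x).
Proof.
move=> oU OU Cu Ox; rewrite /sym_mx /omega linearB /=.
by rewrite (hess_sym oU Cu (OU _ Ox)) Asym.
Qed.

Lemma omega_qform_le u U x v : open U -> Cl `<=` U -> CkOn 2 U u -> Cl x ->
  lmin (omega A u x) * qdot v v <= qform (omega A u x) v.
Proof. by move=> oU OU Cu Ox; apply: lmin_qform_le => //; exact: omega_sym Cu Ox. Qed.

Lemma omega_posdef u U x : open U -> Cl `<=` U -> CkOn 2 U u -> 0 < lambda_u Om A u ->
  Cl x -> mx_posdef (omega A u x).
Proof.
move=> oU OU Cu l0 Ox v v0.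
apply: lt_le_trans (omega_qform_le v oU OU Cu Ox).
by rewrite mulr_gt0 ?lambda_u_le// lt0r qdotvv_eq0 v0 qdotvv_ge0.
Qed.

Lemma subsolution_le k (f : 'rV[R]_n -> R -> 'rV[R]_n -> R) B u ul : (k <= n)%N ->
  mxCkD 3 Om A -> (forall x z p, Cl x -> mx_ge_scalar (mxDz A x z p) 0) ->
  CkD 3 Om f -> (forall x z p, Cl x -> 0 < Dz f x z p) ->
  CkClosed 2 Cl ul -> 0 < lambda_u Om A ul ->
  (forall x, Om x -> f x (ul x) (grad ul x) <= Sk k (omega A ul x)) ->
  CkClosed 2 Cl u ->
  (forall x, Om x -> Sk k (omega A u x - B x (u x) (grad u x)) = f x (u x) (grad u x)) ->
  (forall x z p, Cl x -> skew_mx (B x z p)) ->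
  (forall x, bd x -> u x = ul x) ->
  forall x, Cl x -> ul x <= u x.
Proof.
move=> kn CA DA Cf Df [U1 [oU1 [OU1 C1]]] ll0 Sl [U2 [oU2 [OU2 C2]]] Su Bs ubd x1 Ox1.
rewrite leNgt; apply/negP => lt1.
have [x0 Ox0 x0max] : exists2 c, Cl c & forall x, Cl x -> ul x - u x <= ul c - u c.
  apply: compact_max => //; first by exists x1.
  move=> x Ox; apply: continuousB; first exact: (CkOn_continuous C1 (OU1 _ Ox)).
  exact: (CkOn_continuous C2 (OU2 _ Ox)).
have lt0 : u x0 < ul x0.
  by rewrite -subr_gt0 (lt_le_trans _ (x0max _ Ox1))// subr_gt0.
have [Omx0|nOmx0] := pselect (Om x0); last first.
  by move: lt0; rewrite ubd ?ltxx.
have sub : Om `<=` Cl by exact: subset_closure.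
have [r r0 Or] := open_normP oOm Omx0.
have [eg hle] := touching_above oOm (CkOn_subset (subset_trans sub OU1) C1)
  (CkOn_subset (subset_trans sub OU2) C2) Omx0 r0 (fun y yr => x0max y (sub _ (Or y yr))).
(* With [p] the common gradient, the contradiction is [Sk (omega ul) <= Sk (omega u - B) = f x0 (u
   x0) p < f x0 (ul x0) p]. The first inequality combines [D^2 ul <= D^2 u] with [A] at [u x0] being
   at most [A] at [ul x0]. *)
have := Sl _ Omx0; rewrite leNgt => /negP; apply.
rewrite eg; apply: (@le_lt_trans _ _ (f x0 (u x0) (grad u x0))); last first.
  exact: (CkD_Dz_mono Cf isT Ox0 (fun z => Df x0 z _ Ox0) lt0).
rewrite -(Su _ Omx0); apply: (Sk_qform_le kn).
- exact: omega_sym C1 Ox0.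
- exact: omega_posdef C1 ll0 Ox0.
move=> v; rewrite !qformB (qform_skew _ (Bs _ _ _ Ox0)) subr0 eg lerB//.
apply: (mxCkD_qform_mono CA isT Ox0 (fun z => DA _ z _ Ox0)); exact: ltW.
Qed.

Lemma solution_le_boundary u (M : R) :
  (forall x z, Cl x -> 0 <= lmax (A x z 0)) ->
  CkClosed 2 Cl u -> 0 < lambda_u Om A u ->
  (forall x, bd x -> u x <= M) -> forall x, Cl x -> u x <= M.
Proof.
move=> A0 [U [oU [OU Cu]]] lu0 ubd x1 Ox1.
have [x0 Ox0 x0max] : exists2 c, Cl c & forall x, Cl x -> u x <= u c.
  apply: compact_max => //; first by exists x1.
  by move=> x Ox; exact: (CkOn_continuous Cu (OU _ Ox)).
apply: le_trans (x0max _ Ox1) _.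
have [Omx0|nOmx0] := pselect (Om x0); last exact: ubd.
have sub : Om `<=` Cl by exact: subset_closure.
have [r r0 Or] := open_normP oOm Omx0.
(* Comparison with the zero function yields [Du = 0] and [D^2 u <= 0]. *)
have [|eg hle] := touching_above oOm (CkOn_subset (subset_trans sub OU) Cu)
  (@CkOn_cst0 R n 2 Om) Omx0 r0.
  by move=> y yr; rewrite !subr0; apply: x0max; exact/sub/Or.
have D0 i x : 'D_(evec R i) (fun=> 0 : R) x = 0 by exact: derive_cst.
have D1 i : (fun x => 'D_(evec R i) (fun=> 0 : R) x) = (fun=> 0) by apply/funext => x.
have g0 : grad u x0 = 0 by rewrite eg; apply/rowP => i; rewrite !mxE D0.
have h0 v : qform (hess u x0) v <= 0.
  apply: le_trans (hle v) _; rewrite (_ : hess _ _ = 0) /qform ?mulmx0 ?mul0mx ?mxE//.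
  by apply/matrixP => i j; rewrite !mxE D1 D0.
have [_ [v v0 vE]] := rayleigh_max n0 (Asym (u x0) 0 Ox0).
have := omega_posdef oU OU Cu lu0 Ox0 v0.
rewrite qformB g0 vE subr_gt0 => /lt_le_trans/(_ (h0 v)).
by rewrite ltNge mulr_ge0 ?qdotvv_ge0 ?A0.
Qed.

(* At a maximum of [|Du|^2 exp (4 gamma0 u)], either one can move along [Du]
   inside [Om], and then [A >= - gamma0 (1 + |p|^2)] forces [|Du| <= 1], or the
   maximum is on the boundary, with [Du] not pointing inwards; since
   [D(u - ul)] is there a nonnegative multiple of the inner normal, this gives
   [|Du| <= |D ul|]. *)
Lemma gradient_estimate gamma0 u ul (M0 L : R) : 0 < gamma0 ->
  (forall x0, bd x0 -> exists r : R, 0 < r /\ exists rho : 'rV[R]_n -> R,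
      (forall k, CkOn k (ball x0 r) rho) /\
      (forall x, ball x0 r x -> exists i, 'D_(evec R i) rho x != 0) /\
      (forall x, ball x0 r x -> (Om x <-> rho x < 0))) ->
  (forall x z p, Cl x -> mx_ge_scalar (A x z p) (- gamma0 * (1 + vnorm p ^+ 2))) ->
  CkClosed 2 Cl ul -> CkClosed 2 Cl u -> 0 < lambda_u Om A u ->
  (forall x, bd x -> u x = ul x) -> (forall x, Cl x -> ul x <= u x) ->
  (forall x, Cl x -> `|u x| <= M0) ->
  (forall x, Cl x -> qdot (grad ul x) (grad ul x) <= L) ->
  forall x, Cl x -> qdot (grad u x) (grad u x) <= Num.max 1 L * expR (8 * gamma0 * M0).
Proof.
move=> g0 bdOm Age [U1 [oU1 [OU1 C1]]] [U2 [oU2 [OU2 C2]]] lu0 ubd ulu uM0 ulL.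
(* Since [D^2u(p, p) >= - gamma0 (1 + |p|^2) |p|^2], this weight leaves [2 gamma0 |p|^2 (|p|^2 - 1)]
   as a lower bound of [2 D^2u(p, p) + c |p|^4]. *)
pose c := 4 * gamma0; have c0 : 0 < c by rewrite mulr_gt0.
pose W x := qdot (grad u x) (grad u x) * expR (c * u x).
have [x0 Ox0 x0max] : exists2 y, Cl y & forall x, Cl x -> W x <= W y.
  apply: compact_max => //; first by have [y Oy] := Om0; exists y; exact: subset_closure.
  move=> x Ox; apply: continuousM.
    exact: (continuous_qdot_grad C2 (OU2 _ Ox)).
  apply: (@continuous_comp _ _ _ (fun x => c * u x) expR); last exact: continuous_expR.
  by apply: continuousM; [exact: cst_continuous|exact: (CkOn_continuous C2 (OU2 _ Ox))].
have sub : Om `<=` Cl by exact: subset_closure.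
set p := grad u x0 in x0max *.
have inward : (exists2 e : R, 0 < e & forall t, 0 < t < e -> Om (x0 + t *: p)) -> qdot p p <= 1.
  move=> [e e0 He]; have D := is_derive_grad_expR c oU2 C2 (OU2 _ Ox0).
  have := derive0_max_le0 D e0; rewrite scale0r addr0 -/p.
  have mx t : 0 < t < e -> W (x0 + t *: p) <= W x0 by move=> /He/sub/x0max.
  move=> /(_ mx); rewrite pmulr_rle0 ?expR_gt0// => h.
  have := omega_qform_le p oU2 OU2 C2 Ox0.
  have := Age x0 (u x0) p Ox0 p; rewrite qformB vnorm_sqr -/p.
  have := lambda_u_le lu0 Ox0; have := qdotvv_ge0 p.
  move: h; rewrite /c; set s := qdot p p; set q := qform _ _; set qA := qform _ _.
  move=> h s0 l0 hA hw; rewrite leNgt; apply/negP => s1.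
  have hw0 : 0 <= q - qA by apply: le_trans hw; rewrite mulr_ge0// ltW.
  have : gamma0 * (s * (s - 1)) <= 0 by nra.
  by rewrite leNgt !mulr_gt0// ?subr_gt0// (lt_trans ltr01).
have pK : qdot p p <= Num.max 1 L.
  rewrite le_max; have [Omx0|nOmx0] := pselect (Om x0).
    rewrite inward//; have [r r0 Or] := open_normP oOm Omx0.
    have p1 : 0 < `|p| + 1 by rewrite ltr_wpDl.
    exists (r / (`|p| + 1)); first by rewrite divr_gt0.
    move=> t /andP[t0]; rewrite ltr_pdivlMr// => tr; apply: Or.
    rewrite addrC addKr normrZ gtr0_norm//; apply: le_lt_trans tr.
    by rewrite ler_pM2l// lerDl.
  have [r [r0 [rho [Cr [Dr Or]]]]] := bdOm x0 (conj Ox0 nOmx0).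
  have inw v := @boundary_inward R n Om rho x0 r v r0 Ox0 (Cr 1%N) Or.
  have [lt0|ge0] := ltP (qdot (grad rho x0) p) 0.
    by rewrite inward//; exact: inw.
  apply/orP; right; apply: le_trans (ulL _ Ox0).
  have rho0 : grad rho x0 != 0.
    have [i Di] := Dr x0 (ballxx _ r0).
    by apply: contra_neq Di => /(congr1 (fun g : 'rV[R]_n => g 0 i)); rewrite !mxE.
  (* [u - ul] is nonnegative on the closure and vanishes at [x0], so its derivative along every
     entering direction is nonnegative. *)
  have [|a a0 aE] := @half_space_dual R n (p - grad ul x0) _ rho0.
    move=> v /inw[e e0 He].
    have d1 := is_derive_C1_line0 oU1 v (CkOn_C1On C1 isT) (OU1 _ Ox0).
    have d2 := is_derive_C1_line0 oU2 v (CkOn_C1On C2 isT) (OU2 _ Ox0).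
    have := derive0_max_le0 (is_deriveB d1 d2) e0.
    rewrite -!qdot_grad !fctE !scale0r !addr0 (ubd x0)// subrr => h.
    rewrite qdotC qdotDr -scaleN1r qdotZr mulN1r -oppr_le0 opprB; apply: h.
    by move=> t /He/sub/ulu; rewrite subr_le0.
  have -> : grad ul x0 = p + a *: grad rho x0.
    by rewrite -[a]opprK scaleNr -aE opprB addrC subrK.
  move: ge0; set r1 := grad rho x0 => ge0.
  (* In [|p + a r1|^2] the cross terms are nonnegative because [p] does not point inwards. *)
  rewrite !(qdotDl, qdotDr, qdotZl, qdotZr) [qdot p r1]qdotC -addrA lerDl.
  by rewrite !addr_ge0// ?mulr_ge0// qdotvv_ge0.
move=> x Ox.
have K0 : 0 <= Num.max 1 L by rewrite le_max ler01.
have := x0max _ Ox; rewrite /W -ler_pdivlMr ?expR_gt0//.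
move=> /le_trans; apply; rewrite -/p -[leLHS]mulrA -expRN -expRD.
rewrite ler_pM ?qdotvv_ge0 ?expR_ge0//.
(* The two weights differ by at most [exp (c * 2 M0)], whence the constant [8 * gamma0 * M0]. *)
rewrite ler_expR -mulrBr /c.
have := uM0 _ Ox; have := uM0 _ Ox0; rewrite !ler_norml => /andP[a1 a2] /andP[b1 b2].
by rewrite (_ : 8 * gamma0 * M0 = 4 * gamma0 * (M0 + M0)) ?ler_pM2l//; lra.
Qed.

Lemma hessian_estimate k (f : 'rV[R]_n -> R -> 'rV[R]_n -> R) B u (gt C CA : R) :
  (0 < k <= n)%N -> 0 < gt ->
  CkClosed 2 Cl u -> 0 < lambda_u Om A u -> gt <= gamma_u Om A u ->
  (forall x, Om x -> Sk k (omega A u x - B x (u x) (grad u x)) = f x (u x) (grad u x)) ->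
  (forall x z p, Cl x -> skew_mx (B x z p)) ->
  (forall x, Cl x -> f x (u x) (grad u x) <= C) ->
  (forall x i j, Cl x -> `|A x (u x) (grad u x) i j| <= CA) ->
  forall x i j, Cl x -> `|hess u x i j| <= Num.max 1 C / gt + CA.
Proof.
move=> /andP[k0 kn] g0 [U [oU [OU Cu]]] lu0 gu Su Bs fC AC x i j Ox.
have sub : Om `<=` Cl by exact: subset_closure.
(* The equation holds in the open set [Om]; the bound reaches the closure by continuity of the
   second derivatives. *)
have inOm y : Om y -> `|hess u y i j| <= Num.max 1 C / gt + CA.
  move=> Omy; have Oy := sub _ Omy; set l := lmin (omega A u y).
  have l0 : 0 < l by exact: lambda_u_le.
  (* The maximum with 1 avoids a [k]-th root: if [l > 1], then
     [l <= l ^ k <= Sk k (l%:M) <= f <= C]. *)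
  have lC : l <= Num.max 1 C.
    rewrite le_max; have [//|l1] := leP l 1; apply: le_trans (fC _ Oy).
    rewrite -Su//; apply: le_trans (_ : _ <= Sk k (l%:M : 'M[R]_n)) _.
      rewrite Sk_scalar//; apply: (@le_trans _ _ (l ^+ k)).
        by rewrite -[leLHS]expr1 ler_weXn2l// ltW.
      by rewrite ler_peMl ?exprn_ge0 ?(ltW l0)// ler1n bin_gt0.
    apply: Sk_qform_le => //; first by rewrite /sym_mx tr_scalar_mx.
      by move=> v v0; rewrite qform_scalar mulr_gt0// lt0r qdotvv_eq0 v0 qdotvv_ge0.
    move=> v; rewrite qform_scalar [leRHS]qformB (qform_skew _ (Bs _ _ _ Oy)) subr0.
    exact: omega_qform_le Cu Oy.
  have os := omega_sym oU OU Cu Oy.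
  have -> : hess u y i j = omega A u y i j + A y (u y) (grad u y) i j.
    by rewrite !mxE subrK.
  apply: le_trans (ler_normD _ _) _; apply: lerD; last exact: AC.
  apply: psd_entry_le => // w.
    by apply: le_trans (omega_qform_le w oU OU Cu Oy); rewrite mulr_ge0 ?(ltW l0) ?qdotvv_ge0.
  apply: le_trans ((rayleigh_max n0 os).1 w) _; rewrite ler_wpM2r ?qdotvv_ge0//.
  apply: le_trans (gamma_u_le g0 lu0 gu Oy) _.
  by rewrite ler_pM2r ?invr_gt0.
rewrite leNgt; apply/negP; rewrite -subr_gt0 => e0.
have ch : {for x, continuous (fun y => hess u y i j)}.
  rewrite (_ : (fun y => _) = 'D_(evec R i) ('D_(evec R j) u)).
    exact: (CkOn_deriv_C1On j Cu i (OU _ Ox)).2.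
  by apply/funext => y; rewrite mxE.
have [r r0 Hr] := continuous_normP ch e0.
have [|y [Omy yr]] := Ox (ball x r); first exact: nbhsx_ballx.
move: yr; rewrite -ball_normE /ball_ /= distrC => /Hr.
move=> lt; have := lerB_dist (hess u x i j) (hess u y i j); rewrite distrC.
by move=> /le_lt_trans/(_ lt); rewrite ltrD2l ltrN2 ltNge inOm.
Qed.

End Estimates.

(** * Choice of the constants and assembly of the estimates *)

Theorem theorem1p8 (R : realType) (n k : nat) (Om : set 'rV[R]_n)
  (phi : 'rV[R]_n -> R)
  (A : 'rV[R]_n -> R -> 'rV[R]_n -> 'M[R]_n)
  (f : 'rV[R]_n -> R -> 'rV[R]_n -> R)
  (gamma0 beta1 gt delta gk dk : R) (ul : 'rV[R]_n -> R) :
  (2 <= k <= n)%N ->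
  bounded_domain_smooth Om ->
  SmoothNear (closure Om `\` Om) phi ->
  gammak_spec n k gk ->
  deltak_spec n k gt dk ->
  0 < gk < gt -> gt < 1 -> 0 < delta < dk ->
  (* (i) *)
  mxCkD 3 Om A ->
  (forall x z p, closure Om x -> sym_mx (A x z p)) ->
  0 < gamma0 ->
  (forall x z p, closure Om x ->
     mx_ge_scalar (A x z p) (- gamma0 * (1 + vnorm p ^+ 2))) ->
  (forall x z, closure Om x -> 0 <= lmax (A x z 0)) ->
  (forall x z p, closure Om x -> mx_ge_scalar (mxDz A x z p) 0) ->
  (* (ii) *)
  CkD 3 Om f ->
  (forall x z p, closure Om x -> 0 < f x z p) ->
  0 < beta1 ->
  k%:R * delta / (1 + delta ^+ 2) * beta1
    <= inf [set r : R | exists x z p, closure Om x /\ r = Dz f x z p / f x z p] ->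
  (* (iii) *)
  CkClosed 2 (closure Om) ul ->
  (forall x, Om x -> f x (ul x) (grad ul x) <= Sk k (omega A ul x)) ->
  (forall x, (closure Om `\` Om) x -> ul x = phi x) ->
  gamma_admissible Om A gt ul ->
  exists M0 M1 C3 : R, 0 < M0 /\ 0 < M1 /\ 0 < C3 /\
    forall (u : 'rV[R]_n -> R) (B : 'rV[R]_n -> R -> 'rV[R]_n -> 'M[R]_n),
      (* (iv) *)
      CkClosed 2 (closure Om) u ->
      (forall x, Om x ->
         Sk k (omega A u x - B x (u x) (grad u x)) = f x (u x) (grad u x)) ->
      (forall x, (closure Om `\` Om) x -> u x = phi x) ->
      delta_gamma_admissible Om A B delta gt u ->
      (* (v) *)
      mxBCkD 3 Om B ->
      (forall x z p, closure Om x -> skew_mx (B x z p)) ->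
      muD Om B <= delta * Num.min (lambda_u Om A u) (lambda_u Om A ul) ->
      muD Om (mxDz B) <= beta1 * Num.min (lambda_u Om A u) (lambda_u Om A ul) ->
      supOm Om (fun x => `|u x|) <= M0 /\
      supOm Om (fun x => vnorm (grad u x)) <= M1 /\
      C2norm Om u <= C3.
Proof.
move=> /andP[k2 kn] [oOm [_ [Om0 [[M OmM] bdOm]]]] _ _ _ /andP[gk0 gkgt] _ /andP[delta0 _].
move=> CA Asym gamma00 Age A0 DzA Cf f0 beta10 Dff Cul Sul ulphi [lul0 gul].
have k0 : (0 < k)%N by apply: leq_trans k2.
have n0 : (0 < n)%N by apply: leq_trans kn.
have gt0 : 0 < gt by apply: lt_trans gkgt.
have cOm : compact (closure Om) by exact: bounded_set_compact_closure OmM.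
have [x1 Ox1] : exists x1, closure Om x1 by have [y Oy] := Om0; exists y; exact: subset_closure.
have Df x z p : closure Om x -> 0 < Dz f x z p.
  move=> Ox; have c0 : 0 < k%:R * delta / (1 + delta ^+ 2) * beta1.
    by rewrite !mulr_gt0 ?ltr0n// invr_gt0 ltr_wpDr// sqr_ge0.
  have I0 := lt_le_trans c0 Dff.
  have : 0 < Dz f x z p / f x z p.
    by apply: (lt_le_trans I0); apply: inf_gt0_le => //; exists x, z, p.
  by rewrite pmulr_lgt0// invr_gt0 f0.
have [U1 [oU1 [OU1 C1]]] := Cul.
have [M0 M00 ulM0] : exists2 M0 : R, 0 <= M0 & forall x, closure Om x -> `|ul x| <= M0.
  by apply: compact_bound => // x Ox; exact: (CkOn_continuous C1 (OU1 _ Ox)).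
have [L L0 ulL] : exists2 L : R, 0 <= L &
    forall x, closure Om x -> `|qdot (grad ul x) (grad ul x)| <= L.
  by apply: compact_bound => // x Ox; exact: (continuous_qdot_grad C1 (OU1 _ Ox)).
pose M1 := Num.sqrt (Num.max 1 L * expR (8 * gamma0 * M0)).
have M10 : 0 <= M1 by exact: sqrtr_ge0.
(* One box size for both [u] and the components of [Du], fixed from the data before [u] appears. *)
pose N := M0 + M1.
have [Cmax _ fC] := CkD_bounded N cOm Cf.
have [CA' CA'0 AC] := mxCkD_bounded N cOm CA.
pose K := Num.max 1 Cmax / gt + CA'.
have K0 : 0 <= K by rewrite addr_ge0// divr_ge0 ?(ltW gt0)// le_max ler01.
pose C3 := M0 + \sum_(i < n) M1 + \sum_(i < n) \sum_(j < n) K.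
have C30 : 0 <= C3.
  rewrite !addr_ge0// ?sumr_ge0// => i _; exact: sumr_ge0.
(* The bounds found are only nonnegative; adding 1 makes them positive. *)
exists (M0 + 1), (M1 + 1), (C3 + 1).
do 3![split; first by rewrite ltr_wpDl].
move=> u B Cu Su uphi [[lu0 _] [_ gu]] _ Bs _ _.
have ubd x : (closure Om `\` Om) x -> u x = ul x by move=> bx; rewrite uphi// ulphi.
have ulu : forall x, closure Om x -> ul x <= u x.
  exact: (subsolution_le n0 oOm cOm Asym kn CA DzA Cf Df Cul lul0 Sul Cu Su Bs ubd).
have uM0 x : closure Om x -> `|u x| <= M0.
  move=> Ox; rewrite ler_norml (le_trans _ (ulu _ Ox)) /=.
    apply: (solution_le_boundary n0 oOm cOm Asym A0 Cu lu0) Ox => y by_.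
    by rewrite ubd// (le_trans (ler_norm _))// ulM0//; case: by_.
  by have := ulM0 _ Ox; rewrite ler_norml => /andP[].
have gradM1 x : closure Om x -> vnorm (grad u x) <= M1.
  move=> Ox; rewrite -ler_sqr ?nnegrE ?vnorm_ge0// vnorm_sqr /M1 sqr_sqrtr; last first.
    by rewrite mulr_ge0 ?expR_ge0// le_max ler01.
  apply: (gradient_estimate n0 oOm cOm Om0 Asym gamma00 bdOm Age Cul Cu lu0 ubd ulu uM0) Ox.
  by move=> y Oy; apply: le_trans (ler_norm _) _; exact: ulL.
have gradi x i : closure Om x -> `|'D_(evec R i) u x| <= M1.
  move=> Ox; apply: le_trans (gradM1 _ Ox).
  rewrite -[leRHS]ger0_norm ?vnorm_ge0// -ler_sqr ?nnegrE// !real_normK ?num_real//.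
  by have := sqr_coord_le_qdot (grad u x) i; rewrite vnorm_sqr mxE.
have uN x : closure Om x -> `|u x| <= N by move=> Ox; rewrite (le_trans (uM0 _ Ox))// lerDl.
have gN x : closure Om x -> forall l, `|grad u x 0 l| <= N.
  by move=> Ox l; rewrite mxE (le_trans (gradi _ l Ox))// lerDr.
have hessK x i j : closure Om x -> `|hess u x i j| <= K.
  apply: (hessian_estimate n0 Asym (k := k) (f := f) (B := B)) => //.
  - by rewrite k0.
  - by move=> y Oy; apply: le_trans (ler_norm _) _; apply: fC => //; [exact: uN|exact: gN].
  - by move=> y a b Oy; apply: AC => //; [exact: uN|exact: gN].
have sup_le (g : 'rV[R]_n -> R) c : (forall x, closure Om x -> g x <= c) -> supOm Om g <= c.
  move=> gc; apply: ge_sup; first by exists (g x1), x1.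
  by move=> _ [x Ox <-]; exact: gc.
split; first by apply: sup_le => x Ox; rewrite (le_trans (uM0 _ Ox))// lerDl.
split; first by apply: sup_le => x Ox; rewrite (le_trans (gradM1 _ Ox))// lerDl.
apply: (@le_trans _ _ C3); last by rewrite lerDl.
rewrite /C2norm /C3 !lerD//; first by apply: sup_le.
  by apply: ler_sum => i _; apply: sup_le => x Ox; exact: gradi.
apply: ler_sum => i _; apply: ler_sum => j _; apply: sup_le => x Ox; exact: hessK.
Qed.
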